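(* Let $N\ge 2$ be an integer, let $(X,d,\mathcal H^N)$ be a non-collapsing $\mathsf{RCD}(0,N)$ space and let $\nu\in\mathcal P_2(X)$. Then $$-\mathsf{Ent}_{\mathcal H^N}(\nu)\le\frac N2\log\left(\frac{2\pi e}{N}\mathsf{Var}(\nu)\right).$$
   Context: A metric measure space $(X,d,\mathfrak m)$ consists of a complete separable metric space $(X,d)$ and a locally finite Borel measure $\mathfrak m$ on $X$ with $\operatorname{supp}\mathfrak m=X$ and $\int_X e^{-Cd^2(x_0,x)}\,\mathfrak m(dx)<\infty$ for some $C>0$, $x_0\in X$. $\mathcal P_2(X)$ is the set of Borel probability measures on $X$ with finite second moment, equipped with the $L^2$-Wasserstein distance $W_2$. The relative entropy is $\mathsf{Ent}_{\mathfrak m}(\mu)=\int_{\{\rho>0\}}\rho\log\rho\,d\mathfrak m$ if $\mu=\rho\mathfrak m\ll\mathfrak m$, and $+\infty$ otherwise (it never takes the value $-\infty$ on $\mathcal P_2(X)$), and $U_N(\mu)=\exp(-\frac1N\mathsf{Ent}_{\mathfrak m}(\mu))$. The Cheeger energy of $f\in L^2(\mathfrak m)$ is $\mathsf{Ch}(f)=\frac12\inf\{\liminf_n\int_X(\mathsf{Lip} f_n)^2d\mathfrak m: f_n\text{ locally Lipschitz},\ f_n\to f\text{ in }L^2\}$, where $\mathsf{Lip} f(x)=\limsup_{y\to x}|f(x)-f(y)|/d(x,y)$ ($0$ at isolated points). The space is infinitesimally Hilbertian if $\mathsf{Ch}(f+g)+\mathsf{Ch}(f-g)=2\mathsf{Ch}(f)+2\mathsf{Ch}(g)$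 for all $f,g$ with finite Cheeger energy. For $N\in(1,\infty)$, $(X,d,\mathfrak m)$ is an $\mathsf{RCD}(0,N)$ space if it is infinitesimally Hilbertian and any $\mu_0,\mu_1\in\mathcal P_2(X)$ with finite entropy are joined by a constant speed $W_2$-geodesic $(\mu_t)_{t\in[0,1]}$ with $U_N(\mu_t)\ge(1-t)U_N(\mu_0)+tU_N(\mu_1)$ for all $t\in[0,1]$. A non-collapsing $\mathsf{RCD}(0,N)$ space $(X,d,\mathcal H^N)$ is an $\mathsf{RCD}(0,N)$ space, $N$ an integer, whose reference measure is the $N$-dimensional Hausdorff measure $\mathcal H^N$. $\mathsf{Var}(\nu)=\min_{z\in X}\int_Xd^2(z,y)\,\nu(dy)$. Conventions: $\log 0=-\infty$, and the left-hand side is $-\infty$ if $\mathsf{Ent}_{\mathcal H^N}(\nu)=+\infty$. *)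

(* Defs.v *)
From HB Require Import structures.
From mathcomp Require Import all_boot all_order all_algebra.
From mathcomp Require Import all_classical all_reals all_analysis.

Set Implicit Arguments.
Unset Strict Implicit.
Unset Printing Implicit Defensive.

Import Order.TTheory GRing.Theory Num.Theory.
Import numFieldNormedType.Exports.

Local Open Scope classical_set_scope.
Local Open Scope ring_scope.

(* The distinguished point comes from the library's notions of completeness
   and of measurable space; it carries no information beyond nonemptiness. *)
#[short(type="completeMetricType")]
HB.structure Definition CompleteMetric (K : numDomainType) :=
  {T of CompletePseudoMetric K T & PseudoMetric_isMetric K T}.

Notation borelType X := (g_sigma_algebraType (@open X)).

Definition separable (T : topologicalType) : Prop :=
  exists2 S : set T, countable S & dense S.

Section hausdorff_measure.
Context {R : realType}.

Definition Gamma (s : R) : R :=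
  \int[@lebesgue_measure R]_(t in `]0, +oo[) (t `^ (s - 1) * expR (- t)).

(* Lebesgue measure of the unit ball of R^N. *)
Definition unit_ball_volume (N : nat) : R :=
  pi `^ (N%:R / 2) / Gamma (N%:R / 2 + 1).

Context {X : metricType R}.
Implicit Type A : set X.

Local Open Scope ereal_scope.

(* The maximum with 0 gives the empty set diameter 0 (the supremum of the
   empty set is -oo). *)
Definition diameter A : \bar R :=
  maxe 0 (ereal_sup [set (mdist xy.1 xy.2)%:E | xy in A `*` A]).

Definition hausdorff_premeasure (N : nat) (delta : R) A : \bar R :=
  ereal_inf [set \sum_(0 <= k <oo)
      (unit_ball_volume N)%:E * ((2^-1)%:E * diameter (F k)) ^+ N |
    F in [set F : (set X)^nat |
      A `<=` \bigcup_k F k /\ forall k, diameter (F k) < delta%:E]].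

(* Normalised by the volume of the unit ball, so that on Euclidean R^N it is
   the Lebesgue measure. *)
Definition hausdorff (N : nat) A : \bar R :=
  ereal_sup [set hausdorff_premeasure N delta A |
             delta in [set delta : R | (0 < delta)%R]].

End hausdorff_measure.

Section metric_measure_space.
Context {R : realType} {X : completeMetricType R}.
Implicit Types (m : {measure set (borelType X) -> \bar R})
  (mu nu : probability (borelType X) R).

Local Open Scope ereal_scope.

Definition locally_finite m : Prop :=
  forall x : X, exists2 U : set X, open_nbhs x U & m U < +oo.

Definition msupp m : set X :=
  [set x | forall U : set X, open_nbhs x U -> 0 < m U].

Definition metric_measure_space m : Prop :=
  [/\ separable X, locally_finite m, msupp m = [set: X] &
      exists (C : R) (x0 : X), (0 < C)%R /\
        \int[m]_(x in [set: X]) (expR (- C * mdist x0 x ^+ 2))%:E < +oo].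

Definition second_moment mu (z : X) : \bar R :=
  \int[mu]_(y in [set: X]) (mdist z y ^+ 2)%:E.

Definition in_P2 mu : Prop := exists x0 : X, second_moment mu x0 < +oo.

(* RCD(0,N) spaces with N finite are proper, and on them the infimum is a
   minimum. *)
Definition Var nu : \bar R := ereal_inf (range (second_moment nu)).

Definition meas_eq mu nu : Prop :=
  forall A : set X, measurable (A : set (borelType X)) -> mu A = nu A.

(* For separable X the product sigma-algebra is the Borel sigma-algebra of the
   product, so these are all the Borel couplings. *)
Definition coupling mu nu
    (p : probability (borelType X * borelType X)%type R) : Prop :=
  forall A : set X, measurable (A : set (borelType X)) ->
    pushforward p fst A = mu A /\ pushforward p snd A = nu A.

Definition W2 mu nu : \bar R :=
  sqrte (ereal_inf
    [set \int[p]_(xy in [set: X * X]) (mdist (xy.1 : X) (xy.2 : X) ^+ 2)%:E |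
     p in coupling mu nu]).

Definition W2_geodesic (mu_ : R -> probability (borelType X) R) : Prop :=
  (forall t : R, t \in `[0%R, 1%R] -> in_P2 (mu_ t)) /\
  (forall s t : R, s \in `[0%R, 1%R] -> t \in `[0%R, 1%R] ->
    W2 (mu_ s) (mu_ t) = `|s - t|%:E * W2 (mu_ 0%R) (mu_ 1%R)).

Definition is_density m mu (rho : borelType X -> R) : Prop :=
  [/\ measurable_fun [set: borelType X] rho, forall x, (0 <= rho x)%R &
      forall A : set X, measurable (A : set (borelType X)) ->
        mu A = \int[m]_(x in A) (rho x)%:E].

(* Densities agree m-a.e. (m being sigma-finite), so this is the infimum of a
   set with at most one element; it is +oo exactly when that set is empty or
   the integral of rho log rho is +oo. *)
Definition Ent m mu : \bar R :=
  ereal_inf [set \int[m]_(x in [set x | (0 < rho x)%R])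
                   (rho x * ln (rho x))%:E |
             rho in is_density m mu].

Definition U_ m (N : R) mu : \bar R := expeR (- (N^-1)%:E * Ent m mu).

Definition locally_lipschitz (f : X -> R) : Prop :=
  forall x : X, exists U : set X, exists L : R, open_nbhs x U /\
    forall y z, U y -> U z -> (`|f y - f z| <= L * mdist y z)%R.

(* At an isolated point x the punctured neighbourhood filter contains the
   empty set and the limsup is -oo; elsewhere it is nonnegative. *)
Definition Lip (f : X -> R) (x : X) : \bar R :=
  maxe 0 (limf_esup (fun y : X => (`|f x - f y| / mdist x y)%:E) x^').

Definition cvg_L2 m (f_ : (X -> R)^nat) (f : X -> R) : Prop :=
  Lnorm m 2%:E (fun x => (f_ n x - f x)%:E) @[n --> \oo] --> 0.

Definition Ch m (f : X -> R) : \bar R :=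
  (2^-1)%:E * ereal_inf
    [set limn_einf (fun n => \int[m]_(x in [set: X]) (Lip (f_ n) x ^+ 2)) |
     f_ in [set f_ : (X -> R)^nat |
            (forall n, locally_lipschitz (f_ n)) /\ cvg_L2 m f_ f]].

Definition infinitesimally_hilbertian m : Prop :=
  forall f g : borelType X -> R,
    f \in Lfun m 2%:E -> g \in Lfun m 2%:E -> Ch m f < +oo -> Ch m g < +oo ->
    Ch m (fun x => f x + g x)%R + Ch m (fun x => f x - g x)%R
      = 2%:E * Ch m f + 2%:E * Ch m g.

Definition RCD0 m (N : R) : Prop :=
  [/\ metric_measure_space m, infinitesimally_hilbertian m &
      forall mu0 mu1, in_P2 mu0 -> in_P2 mu1 ->
        Ent m mu0 \is a fin_num -> Ent m mu1 \is a fin_num ->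
        exists mu_ : R -> probability (borelType X) R,
          [/\ meas_eq (mu_ 0%R) mu0, meas_eq (mu_ 1%R) mu1,
              W2_geodesic mu_ &
              forall t : R, t \in `[0%R, 1%R] ->
                (1 - t)%:E * U_ m N mu0 + t%:E * U_ m N mu1
                  <= U_ m N (mu_ t)]].

Definition noncollapsed_RCD0 m (N : nat) : Prop :=
  RCD0 m N%:R /\
  forall A : set X, measurable (A : set (borelType X)) ->
    m A = hausdorff N A.

End metric_measure_space.

(* Main.v *)
From HB Require Import structures.
Require Import Defs.
From mathcomp Require Import all_boot all_order all_algebra.
From mathcomp Require Import all_classical all_reals all_analysis.
From mathcomp Require Import measurable_realfun ring lra.

Set Implicit Arguments.
Unset Strict Implicit.
Unset Printing Implicit Defensive.

Import Order.TTheory GRing.Theory Num.Theory.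
Import numFieldNormedType.Exports.

Local Open Scope classical_set_scope.
Local Open Scope ring_scope.

(** Compare nu with a Gaussian.  If the function exp(-d(z,.)^2/(2 s^2)) has mass
    Z(s) for the reference measure m, Jensen's inequality gives, for every
    probability mu with second moment V around z,
      -Ent(mu) <= V / (2 s^2) + log Z(s)                          ([Ent_ge]).
    Were Z(s) <= (2 pi s^2)^(N/2) for all s, the choice mu = nu, s^2 = V / N
    would finish the proof.  That global bound amounts to Bishop-Gromov; the
    proof only uses it in the limit s -> 0, where Z(s) is governed by the
    density of m at z ([gaussian_mass_le]), and lets the curvature condition
    carry nu to small scales.

    Join a measure concentrated near z to nu by a geodesic (mu_t) as in the
    curvature-dimension condition.  The second moment of mu_t around z is about
    t^2 V, because the geodesic starts essentially at the Dirac mass at z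
    ([geodesic_second_moment]), while concavity of the entropy power U_N gives
    U_N(mu_t) >= t U_N(nu).  The Jensen bound for mu_t with the width s t then
    reads, after taking logarithms,
      N log t - Ent(nu) <= V / (2 s^2) + log Z(s t),
    and Z(s t) is at most about (2 pi s^2)^(N/2) t^N: the powers of t cancel
    ([entropy_bound_at]).

    The density input is that, for m = H^N of finite mass on an open set U,
    some point z of U has m(B(z,r)) <= (1 + eta) w_N r^N for all small r: were
    it false throughout U, balls carrying too much mass would form a fine cover
    of U, and a Vitali selection from them would give
    H^N(U) <= m(U) / (1 + eta) ([exists_upper_density_le]).  Such points are
    dense since m has full support, and the second moment is upper
    semicontinuous in z, so the bound passes to every z
    ([entropy_bound_everywhere]).  It remains to take the infimum over z and
    to optimise in s ([entropy_of_variance_bounds]). *)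

(** * Distances and Borel sets *)

Section metric.
Context {R : realType} {X : completeMetricType R}.
Implicit Types (x y z : X) (r : R).

Definition cball z r : set X := [set y | mdist z y <= r].

Lemma open_borel (A : set X) : open A -> measurable (A : set (borelType X)).
Proof. by move=> oA; apply: sub_sigma_algebra. Qed.

Lemma closed_borel (A : set X) :
  closed A -> measurable (A : set (borelType X)).
Proof.
move=> cA; rewrite -[A]setCK; apply: (@measurableC _ (borelType X)).
by apply: open_borel; exact: closed_openC.
Qed.

Lemma open_mdist_lt z r : open [set y : X | mdist z y < r].
Proof.
rewrite openE => y /= yr; apply/nbhs_ballP; exists (r - mdist z y) => /=.
  by rewrite subr_gt0.
move=> w; rewrite ballEmdist/= => yw.
by have := metric_triangle z y w; lra.
Qed.

Lemma cball_closed z r : closed (cball z r).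
Proof.
rewrite -openC /cball openE => y /negP; rewrite -ltNge => ry.
apply/nbhs_ballP; exists (mdist z y - r) => /=; first by rewrite subr_gt0.
move=> w; rewrite ballEmdist/= => yw; apply/negP; rewrite -ltNge.
by have := metric_triangle z w y; rewrite (metric_sym w y); lra.
Qed.

Lemma cball_measurable z r : measurable (cball z r : set (borelType X)).
Proof. by apply: closed_borel; exact: cball_closed. Qed.

Lemma measurable_mdist z :
  measurable_fun [set: borelType X] (fun y : borelType X => mdist z y : R).
Proof.
move=> _; apply: (measurability _ (RGenInftyO.measurableE R)) => //.
move=> _ [_ [a ->] <-]; rewrite setTI.
rewrite (_ : _ @^-1` _ = [set y : X | mdist z y < a]).
  by apply: open_borel; exact: open_mdist_lt.
by apply/seteqP; split => y /=; rewrite in_itv.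
Qed.

Lemma measurable_mdist_sqr z :
  measurable_fun [set: borelType X] (fun y : borelType X => mdist z y ^+ 2 : R).
Proof. by apply: measurable_funX; exact: measurable_mdist. Qed.

(** The squared triangle inequality is used in this weighted form: with k small
    the second term loses nothing in the limit, which replaces Minkowski's
    inequality. *)
Lemma sqrD_le (k a b : R) : 0 < k ->
  (a + b) ^+ 2 <= (1 + k^-1) * a ^+ 2 + (1 + k) * b ^+ 2.
Proof.
move=> k0; rewrite -subr_ge0.
have -> : (1 + k^-1) * a ^+ 2 + (1 + k) * b ^+ 2 - (a + b) ^+ 2 =
  k^-1 * (a - k * b) ^+ 2 by field; rewrite gt_eqF.
by rewrite mulr_ge0 ?sqr_ge0// invr_ge0 ltW.
Qed.

Lemma mdist_sqr_le (k : R) x y z : 0 < k ->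
  mdist x z ^+ 2 <= (1 + k^-1) * mdist x y ^+ 2 + (1 + k) * mdist y z ^+ 2.
Proof.
move=> k0; apply: le_trans (sqrD_le _ _ k0).
by rewrite lerXn2r ?nnegrE ?addr_ge0 ?mdist_ge0// metric_triangle.
Qed.

End metric.

Section product_metric.
Context {R : realType} {X : completeMetricType R}.

(** d(x, y) is the infimum of d(s, x) + d(s, y) over a countable dense set of s,
    and each of these sums is measurable for the product sigma-algebra. *)
Lemma measurable_mdist_prod : separable X ->
  measurable_fun [set: borelType X * borelType X]
    (fun xy : borelType X * borelType X => mdist (xy.1 : X) (xy.2 : X) : R).
Proof.
move=> [S cS dS] _; apply: (measurability _ (RGenInftyO.measurableE R)) => //.
move=> _ [_ [a ->] <-]; rewrite setTI.
rewrite (_ : _ @^-1` _ = \bigcup_(s in S)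
  [set xy : borelType X * borelType X | mdist s xy.1 + mdist s xy.2 < a]).
  (* an injection of the dense set into nat turns the union into a sequence *)
  have [f finj] := countable_injP _ cS.
  pose F s := [set xy : borelType X * borelType X |
    mdist s xy.1 + mdist s xy.2 < a].
  rewrite (_ : \bigcup_(s in S) _ =
    \bigcup_n \bigcup_(s in [set s | S s /\ f s = n]) F s); last first.
    apply/seteqP; split => xy; first by move=> [s Ss sa]; exists (f s) => //; exists s.
    by move=> [n _ [s [Ss _] sa]]; exists s.
  apply: bigcupT_measurable => n.
  have [[s [Ss sn]]|ns] := pselect (exists s, S s /\ f s = n); last first.
    rewrite (_ : [set s | _] = set0) ?bigcup_set0//.
    by apply/seteqP; split => // s sP; apply: ns; exists s.
  rewrite (_ : [set s | _] = [set s]); last first.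
    apply/seteqP; split => [t [St tn]|t -> //].
    by apply: finj; rewrite ?inE// sn tn.
  rewrite bigcup_set1.
  have mF : measurable_fun [set: borelType X * borelType X]
      (fun xy : borelType X * borelType X => mdist s xy.1 + mdist s xy.2 : R).
    by apply: measurable_funD; apply: measurableT_comp => //; exact: measurable_mdist.
  rewrite -[F s]setTI (_ : F s = (fun xy : borelType X * borelType X =>
    mdist s xy.1 + mdist s xy.2 : R) @^-1` `]-oo, a[%classic); first exact: mF.
  by apply/seteqP; split => xy /=; rewrite in_itv.
apply/seteqP; split => -[x y] /=; rewrite in_itv/=.
  move=> xya; have e0 : 0 < (a - mdist x y) / 2 by rewrite divr_gt0// subr_gt0.
  have [|s [xs Ss]] := dS [set w | mdist x w < (a - mdist x y) / 2] _ (open_mdist_lt _ _).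
    by exists x => /=; rewrite mdistxx.
  exists s => //=; rewrite (metric_sym s x).
  have := metric_triangle s x y; rewrite (metric_sym s x).
  by move: xs => /=; lra.
move=> [s Ss /= sa]; apply: le_lt_trans sa.
by rewrite (metric_sym s x) metric_triangle.
Qed.

End product_metric.

Lemma measurable_mdist_sqr_prod (R : realType) (X : completeMetricType R) :
  separable X ->
  measurable_fun [set: borelType X * borelType X]
    (fun xy : borelType X * borelType X =>
      mdist (xy.1 : X) (xy.2 : X) ^+ 2 : R).
Proof. by move=> sepX; apply: measurable_funX; exact: measurable_mdist_prod. Qed.

(** * Greedy selection of disjoint balls *)

Section covering.
Context {R : realType} {X : completeMetricType R}.
Implicit Types (x y z : X) (r : R) (p q : X * R).

Lemma cball_lt0 x r : r < 0 -> cball x r = set0.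
Proof.
move=> r0; rewrite -subset0 => y /= xyr.
by have := mdist_ge0 x y; rewrite leNgt (le_lt_trans xyr r0).
Qed.

Lemma diameter_cball x r : (diameter (cball x r) <= (2 * Num.max r 0)%:E)%E.
Proof.
rewrite /diameter ge_max lee_fin mulr_ge0 ?le_max ?lexx ?orbT//=.
apply: ge_ereal_sup => _ [[y z] [/= xy xz] <-]; rewrite lee_fin.
have := metric_triangle y x z; rewrite (metric_sym y x).
move: xy xz; rewrite /cball/=.
have : r <= Num.max r 0 by rewrite le_max lexx.
by lra.
Qed.

(** One step of the selection: among the balls of the family F that avoid C, one
    whose radius is more than half the supremum.  When no ball is left the
    answer is a ball of negative radius, that is, the empty set. *)
Lemma greedy_next (F : set (X * R)) (delta : R) (C : set X) :
  (forall p, F p -> 0 < p.2 <= delta) ->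
  let A := [set q | F q /\ cball q.1 q.2 `&` C = set0] in
  exists p, (A p \/ p.2 < 0) /\ forall q, A q -> q.2 <= 2 * p.2.
Proof.
move=> Fd A; have [[q0 Aq0]|nA] := pselect (exists q, A q); last first.
  exists (point, -1); split; first by right; rewrite /= ltrN10.
  by move=> q Aq; exfalso; apply: nA; exists q.
have hs : has_sup [set q.2 | q in A].
  split; first by exists q0.2, q0.
  by exists delta => _ [q [Fq _] <-]; have /andP[] := Fd _ Fq.
have s0 : 0 < sup [set q.2 | q in A].
  apply: (@lt_le_trans _ _ q0.2); first by have /andP[] := Fd _ Aq0.1.
  by apply: ub_le_sup; [exact: hs.2|exists q0].
have [|_ [p Ap <-] sp] := sup_adherent (eps := sup [set q.2 | q in A] / 2) _ hs.
  by rewrite divr_gt0.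
exists p; split; first by left.
move=> q Aq; have : q.2 <= sup [set q.2 | q in A].
  by apply: ub_le_sup; [exact: hs.2|exists q].
by lra.
Qed.

(** Iterating the step gives the selection of Vitali's covering lemma.  A ball
    of F that avoids the first n selected balls was a candidate for the n-th
    choice, hence has at most twice its radius. *)
Lemma greedy_disjoint_cballs (F : set (X * R)) (delta : R) :
  (forall p, F p -> 0 < p.2 <= delta) ->
  exists p : nat -> X * R,
    [/\ forall n, F (p n) \/ (p n).2 < 0,
        trivIset setT (fun n => cball (p n).1 (p n).2) &
        forall q n, F q ->
          (forall i, (i < n)%N ->
            cball q.1 q.2 `&` cball (p i).1 (p i).2 = set0) ->
          q.2 <= 2 * (p n).2].
Proof.
move=> Fd; have [next nextP] := choice (fun C => greedy_next C Fd).
pose C := fix C n := if n is n'.+1 then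
  C n' `|` cball (next (C n')).1 (next (C n')).2 else set0.
pose D i := cball (next (C i)).1 (next (C i)).2.
have CE n : C n = \bigcup_(i < n) D i.
  elim: n => [|n IH]; first by rewrite bigcup_mkord big_ord0.
  rewrite bigcup_mkord big_ord_recr -bigcup_mkord -IH.
  reflexivity.
exists (fun n => next (C n)); split.
- by move=> n; have [[[Fn _]|n0] _] := nextP (C n); [left|right].
- apply/trivIsetP => i j _ _.
  wlog ij : i j / (i < j)%N.
    move=> wlg; rewrite neq_lt => /orP[ij|ij]; first by rewrite wlg// lt_eqF.
    by rewrite setIC wlg// lt_eqF.
  move=> _; rewrite setIC; have [[[_ jC]|/cball_lt0 ->] _] := nextP (C j).
    rewrite -subset0 => x [jx ix]; rewrite -jC; split => //.
    by rewrite CE; exists i.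
  by rewrite set0I.
- move=> q n Fq qn; have [_] := nextP (C n); apply; split => //.
  rewrite -subset0 => x [qx]; rewrite CE => -[i ni ix].
  by rewrite -(qn i ni).
Qed.

End covering.

(** * Upper density of the Hausdorff measure *)

Section upper_density.
Context {R : realType} {X : completeMetricType R}.
Variables (m : {measure set (borelType X) -> \bar R}) (N : nat).
Local Notation w := (@unit_ball_volume R N).
Hypothesis N_gt0 : (0 < N)%N.
Hypothesis w_gt0 : 0 < w.

(** Vitali covering without a doubling assumption.  Select disjoint balls B_n of
    radius rho_n from the given ones; their total premeasure
    S = sum_n w rho_n^N is at most m U / c.  For every k the set U is covered by
    B_0, ..., B_(k-1) and the balls (3 B_n) for n >= k, so the premeasure of U
    is at most S plus 3^N times the tail of a convergent series. *)
Lemma premeasure_le_of_fine_cover (U : set X) (c delta : R) :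
  open U -> (m U < +oo)%E -> 0 < c -> 0 < delta ->
  (forall z, U z -> forall r0, 0 < r0 ->
    exists r, 0 < r < r0 /\ ((c * (w * r ^+ N))%:E <= m (cball z r))%E) ->
  (c%:E * hausdorff_premeasure N delta U <= m U)%E.
Proof.
move=> oU mU c0 d0 fine_cover.
pose F := [set p : X * R | [/\ 0 < p.2 < delta / 8, cball p.1 p.2 `<=` U &
  ((c * (w * p.2 ^+ N))%:E <= m (cball p.1 p.2))%E]].
have Fd p : F p -> 0 < p.2 <= delta / 8.
  by move=> [/andP[-> /ltW ->]].
have [p [Fp tB greedy]] := greedy_disjoint_cballs Fd.
pose B n := cball (p n).1 (p n).2.
pose rho n := Num.max (p n).2 0.
pose a n := w * rho n ^+ N.
have rho0 n : 0 <= rho n by rewrite le_max lexx orbT.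
have a0 n : 0 <= a n by rewrite mulr_ge0 ?exprn_ge0// ltW.
have rhoE n : 0 <= (p n).2 -> rho n = (p n).2 by move=> /max_l.
have caB n : ((c * a n)%:E <= m (B n))%E.
  have [[/andP[r0 _] _]|r0] := Fp n; first by rewrite /a rhoE// ltW.
  by rewrite /a /rho (max_r (ltW r0)) expr0n gtn_eqF// !mulr0 measure_ge0.
have BU n : B n `<=` U.
  by have [[_ //]|/cball_lt0] := Fp n; rewrite /B => ->.
have mB n : measurable (B n : set (borelType X)) by exact: cball_measurable.
have sumB : (\sum_(0 <= n <oo) m (B n) <= m U)%E.
  rewrite -measure_semi_bigcup//; last exact: bigcupT_measurable.
  apply: le_measure; rewrite ?inE//; first exact: bigcupT_measurable.
    exact: open_borel.
  by move=> x [n _ /BU].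
have sumca : (c%:E * \sum_(0 <= n <oo) (a n)%:E <= m U)%E.
  rewrite -nneseriesZl//; last by move=> n _; rewrite lee_fin.
  apply: le_trans sumB; apply: lee_nneseries => n _.
    by rewrite mule_ge0 ?lee_fin// ltW.
  by rewrite -EFinM.
have suma : (\sum_(0 <= n <oo) (a n)%:E < +oo)%E.
  rewrite ltey; apply/eqP => ay; move: sumca; rewrite ay gt0_muley ?lte_fin//.
  by rewrite leNgt mU.
apply: le_trans sumca; rewrite lee_pmul2l ?lte_fin//.
have tail e : 0 < e -> exists k, (\sum_(k <= n <oo) (a n)%:E < e%:E)%E.
  move=> e0.
  have /fine_cvgP[fk] := nneseries_tail_cvg suma (fun n _ => a0 n).
  move=> /cvgrPdist_lt/(_ _ e0) [k1 _ k1P].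
  case: fk => k2 _ k2P; exists (maxn k1 k2).
  have {k1P} := k1P _ (leq_maxl k1 k2); have {k2P} := k2P _ (leq_maxr k1 k2).
  rewrite /= sub0r normrN => fk; rewrite ltr_norml => /andP[_].
  by rewrite -lte_fin fineK.
(* a ball avoiding all B_n would keep every rho_n above half its radius *)
have meets q : F q -> exists n, cball q.1 q.2 `&` B n !=set0.
  move=> Fq; apply: contrapT => nomeet.
  have far n : cball q.1 q.2 `&` B n = set0.
    by apply: contrapT => /eqP/set0P qn; apply: nomeet; exists n.
  have /andP[q0 _] := Fd _ Fq.
  have qa n : w * (q.2 / 2) ^+ N <= a n.
    have qn : q.2 <= 2 * (p n).2 by apply: greedy => // i _; exact: far.
    rewrite /a ler_pM2l// lerXn2r ?nnegrE ?divr_ge0 ?(ltW q0)//.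
    by rewrite le_max ler_pdivrMr// [_ * 2]mulrC qn.
  have [|k] := tail (w * (q.2 / 2) ^+ N).
    by rewrite mulr_gt0// exprn_gt0// divr_gt0.
  rewrite ltNge => /negP; apply; rewrite (le_trans _ (nneseries_lim_ge k.+1 _))//.
    by rewrite big_nat1 lee_fin.
  by move=> n _ _; rewrite lee_fin.
apply/lee_addgt0Pr => e e0.
have [k tk] : exists k, (\sum_(k <= n <oo) (a n)%:E < (e / 3 ^+ N)%:E)%E.
  by apply: tail; rewrite divr_gt0// exprn_gt0.
(* G is the cover of U by k original and infinitely many tripled balls *)
pose radius n := if (n < k)%N then rho n else 3 * rho n.
pose G n := if (n < k)%N then B n else cball (p n).1 (3 * (p n).2).
pose b n := if (n < k)%N then 0 else a n.
have radius0 n : 0 <= radius n by rewrite /radius; case: ifP => // _; rewrite mulr_ge0.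
have diamG n : (diameter (G n) <= (2 * radius n)%:E)%E.
  rewrite /G /radius; case: ifP => _; rewrite (le_trans (diameter_cball _ _))//.
  by rewrite lee_fin ler_pM2l// /rho maxr_pMr// mulr0.
have rho_lt n : rho n < delta / 8.
  have [[/andP[r0 r1] _] _|r0] := Fp n; first by rewrite rhoE// ltW.
  by rewrite /rho (max_r (ltW r0)) divr_gt0.
have coverG : U `<=` \bigcup_n G n.
  move=> x Ux; have [[n nk xn]|xk] := pselect (exists2 n, (n < k)%N & B n x).
    by exists n => //; rewrite /G nk.
  (* a small ball of F around x avoids the closed set B_0, ..., B_(k-1); let n
     be the first index of a selected ball that it meets *)
  pose V := U `&` ~` (\bigcup_(n < k) B n).
  have oV : open V.
    apply: openI => //; rewrite bigcup_mkord; apply: closed_openC.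
    by apply: closed_bigsetU => n _; exact: cball_closed.
  have Vx : V x by split => // -[n nk xn]; apply: xk; exists n.
  have /nbhs_ballP[r1 /= r10 r1V] : nbhs x V by apply: open_nbhs_nbhs.
  have [|r [/andP[r0 rr] wr]] := fine_cover x Ux (Num.min r1 (delta / 8)).
    by rewrite lt_min r10 divr_gt0.
  move: rr; rewrite lt_min => /andP[rr1 rd].
  have rV : cball x r `<=` V.
    by move=> y xy; apply: r1V; rewrite ballEmdist/= (le_lt_trans xy).
  have Fq : F (x, r).
    by split => //=; [rewrite r0|move=> y /rV[]].
  have [n0 xn0] := meets _ Fq.
  have exn : exists n, `[< cball x r `&` B n !=set0 >] by exists n0; apply/asboolP.
  have [n /asboolP[y [xy ny]] nmin] := ex_minnP exn.
  have kn : (k <= n)%N.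
    rewrite leqNgt; apply/negP => nk; have [_] := rV _ xy; apply.
    by exists n.
  have rn : r <= 2 * (p n).2.
    apply: (greedy (x, r)) => // i iln; apply: contrapT => /eqP/set0P ri.
    by have := nmin i (asboolT ri); rewrite leqNgt iln.
  exists n => //; rewrite /G ltnNge kn /= /cball /=.
  have := metric_triangle (p n).1 y x; rewrite (metric_sym y x).
  by move: xy ny; rewrite /B /cball /=; lra.
have : (hausdorff_premeasure N delta U <=
    \sum_(0 <= n <oo) w%:E * ((2^-1)%:E * diameter (G n)) ^+ N)%E.
  apply: ereal_inf_lbound; exists G => //; split => // n.
  rewrite (le_lt_trans (diamG n))// lte_fin /radius.
  by have := rho_lt n; have := rho0 n; case: ifP => _; lra.
move=> /le_trans; apply.
apply: (@le_trans _ _ (\sum_(0 <= n <oo) ((a n)%:E + (3 ^+ N)%:E * (b n)%:E))%E).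
  apply: lee_nneseries => n _.
    by rewrite mule_ge0 ?lee_fin ?(ltW w_gt0)// expe_ge0// mule_ge0// le_max lexx.
  apply: (@le_trans _ _ (w * radius n ^+ N)%:E).
    have dG0 : (0 <= diameter (G n))%E by rewrite le_max lexx.
    have := diamG n; rewrite -(@fineK _ (diameter (G n))); last first.
      by rewrite ge0_fin_numE// (le_lt_trans (diamG n)) ?ltry.
    rewrite lee_fin => dn; rewrite -EFinM -EFin_expe -EFinM lee_fin ler_pM2l//.
    rewrite lerXn2r ?nnegrE ?mulr_ge0 ?fine_ge0//.
    by rewrite mulrC ler_pdivrMr// mulrC.
  rewrite -EFinM -EFinD lee_fin /radius /b /a; case: ifP => _.
    by rewrite mulr0 addr0.
  by rewrite exprMn mulrCA lerDr -/(a n).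
rewrite nneseriesD; last 2 first.
- by move=> n _ _; rewrite lee_fin.
- move=> n _ _; rewrite -EFinM lee_fin /b; case: ifP => _; first by rewrite mulr0.
  by rewrite mulr_ge0// exprn_ge0.
have b0 n : 0 <= b n by rewrite /b; case: ifP.
rewrite leeD2l// nneseriesZl//; last by move=> n _; rewrite lee_fin.
rewrite (nneseries_split 0 k); last by move=> n _; rewrite lee_fin.
rewrite add0n big_nat_cond big1 ?add0e; last first.
  by move=> n /andP[/andP[_ nk] _]; rewrite /b nk.
rewrite -lee_pdivlMl ?exprn_gt0// -EFinM mulrC (le_trans _ (ltW tk))//.
apply: lee_nneseries => [n _ _|n _]; first by rewrite lee_fin.
by rewrite lee_fin /b; case: ifP.
Qed.

Lemma hausdorff_le_of_fine_cover (U : set X) (c : R) :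
  open U -> (m U < +oo)%E -> 0 < c ->
  (forall z, U z -> forall r0, 0 < r0 ->
    exists r, 0 < r < r0 /\ ((c * (w * r ^+ N))%:E <= m (cball z r))%E) ->
  (c%:E * hausdorff N U <= m U)%E.
Proof.
move=> oU mU c0 fine_cover.
rewrite muleC -lee_pdivlMr//; apply: ge_ereal_sup => _ [delta /= d0 <-].
by rewrite lee_pdivlMr// muleC premeasure_le_of_fine_cover.
Qed.

Hypothesis m_hausdorff :
  forall A : set X, measurable (A : set (borelType X)) -> m A = hausdorff N A.

(** If every point of U were the centre of arbitrarily small balls of mass more
    than (1 + eta) w r^N, the covering bound would give
    (1 + eta) m U <= m U. *)
Lemma exists_upper_density_le (U : set X) (eta : R) :
  open U -> (0 < m U)%E -> (m U < +oo)%E -> 0 < eta ->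
  exists z, U z /\ exists r0, 0 < r0 /\ forall r, 0 < r < r0 ->
    (m (cball z r) <= ((1 + eta) * (w * r ^+ N))%:E)%E.
Proof.
move=> oU U0 Uy eta0; apply: contrapT => nodensity.
have c0 : 0 < 1 + eta by rewrite addr_gt0.
have : ((1 + eta)%:E * hausdorff N U <= m U)%E.
  apply: hausdorff_le_of_fine_cover => // z Uz r0 r00.
  apply: contrapT => nor; apply: nodensity; exists z; split => //.
  exists r0; split => // r rr0; rewrite leNgt; apply/negP => mr.
  by apply: nor; exists r; split => //; exact: ltW.
rewrite -m_hausdorff; last exact: open_borel.
have Ufin : m U \is a fin_num by rewrite ge0_fin_numE.
move: U0; rewrite -(fineK Ufin) -EFinM lee_fin lte_fin => U0.
by rewrite -subr_le0 mulrDl mul1r addrAC subrr add0r leNgt mulr_gt0.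
Qed.

End upper_density.

(** * The Gibbs variational inequality *)

Section density.
Context d (T : measurableType d) (R : realType).
Variables (m mu : {measure set T -> \bar R}) (rho : T -> R).
Hypothesis mrho : measurable_fun [set: T] rho.
Hypothesis rho0 : forall x, 0 <= rho x.
Hypothesis rhoE : forall A, measurable A ->
  mu A = (\int[m]_(x in A) (rho x)%:E)%E.
Import HBNNSimple.
Local Open Scope ereal_scope.

Let nnsfunE (f : {nnsfun T >-> R}) :
  \int[m]_x ((f x)%:E * (rho x)%:E) = \int[mu]_x (f x)%:E.
Proof.
have mpre k : measurable (f @^-1` [set k]) by exact: measurable_sfunP.
transitivity (\sum_(k \in range f)
    \int[m]_x ((k * \1_(f @^-1` [set k]) x)%:E * (rho x)%:E)).
  rewrite -ge0_integral_fsum//; last 2 first.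
  - move=> k; apply: emeasurable_funM; last exact/measurable_EFinP.
    exact/measurable_EFinP/measurable_funM.
  - by move=> k x _; rewrite mule_ge0 ?nnfun_muleindic_ge0 ?lee_fin.
  apply: eq_integral => x _; rewrite {1}fimfunE -fsumEFin//.
  by rewrite ge0_mule_fsuml// => k; exact: nnfun_muleindic_ge0.
transitivity (\sum_(k \in range f) \int[mu]_x (k * \1_(f @^-1` [set k]) x)%:E).
  apply: eq_fsbigr => k; rewrite inE => -[y _ fyk].
  have k0 : (0 <= k)%R by rewrite -fyk.
  under eq_integral do rewrite EFinM -muleA.
  under [in RHS]eq_integral do rewrite EFinM.
  have ind0 x : 0 <= (\1_(f @^-1` [set k]) x)%:E :> \bar R by rewrite lee_fin.
  have mind : measurable_fun [set: T] 
      (fun x => (\1_(f @^-1` [set k]) x)%:E : \bar R).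
    by apply/measurable_EFinP; exact: measurable_indic.
  rewrite !ge0_integralZl ?lee_fin//; last 2 first.
  - by apply: emeasurable_funM => //; exact/measurable_EFinP.
  - by move=> x _; rewrite mule_ge0 ?lee_fin.
  congr (_ * _); rewrite integral_indic// setIT rhoE//.
  rewrite [in RHS]integral_mkcond; apply: eq_integral => x _.
  by rewrite patchE indicE; case: ifP => _; rewrite ?mul1e ?mul0e.
rewrite -ge0_integral_fsum//.
- by apply: eq_integral => x _; rewrite fsumEFin// -fimfunE.
- by move=> k; exact/measurable_EFinP/measurable_funM.
- by move=> k x _; rewrite nnfun_muleindic_ge0.
Qed.

Lemma ge0_integral_density (f : T -> R) :
  measurable_fun [set: T] f -> (forall x, (0 <= f x)%R) ->
  \int[m]_x (f x * rho x)%:E = \int[mu]_x (f x)%:E.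
Proof.
move=> mf f0.
have mEf : measurable_fun [set: T] (EFin \o f) by exact/measurable_EFinP.
pose f_ := nnsfun_approx measurableT mEf.
have cvgf x : (f_ n x)%:E @[n --> \oo] --> (f x)%:E.
  by apply: (cvg_nnsfun_approx measurableT mEf) => // y _; rewrite lee_fin.
have ndf x : nondecreasing_seq (fun n => f_ n x).
  by move=> a b ab; exact/lefP/nd_nnsfun_approx.
transitivity (limn (fun n => \int[m]_x ((f_ n x)%:E * (rho x)%:E))).
  rewrite -monotone_convergence//.
  - apply: eq_integral => x _; apply/esym/cvg_lim => //.
    by rewrite EFinM; apply: cvgeZr.
  - move=> n; apply: emeasurable_funM; last exact/measurable_EFinP.
    exact/measurable_EFinP.
  - by move=> n x _; rewrite mule_ge0 ?lee_fin.
  - move=> x _ a b ab; rewrite lee_wpmul2r ?lee_fin//; exact: ndf.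
under eq_fun do rewrite nnsfunE.
rewrite -monotone_convergence//.
- by apply: eq_integral => x _; exact/cvg_lim.
- by move=> n; exact/measurable_EFinP.
- by move=> n x _; rewrite lee_fin.
- by move=> x _ a b ab; rewrite lee_fin; exact: ndf.
Qed.

End density.

Lemma measurable_le_integral d (T : measurableType d) (R : realType)
    (m : {measure set T -> \bar R}) (D : set T) (f g : T -> \bar R) :
  measurable D -> measurable_fun D f -> measurable_fun D g ->
  (forall x, D x -> f x <= g x)%E ->
  (\int[m]_(x in D) f x <= \int[m]_(x in D) g x)%E.
Proof.
move=> mD mf mg fg; rewrite integralE [leRHS]integralE leeB//.
- apply: ge0_le_integral => //; [exact: measurable_funepos..|].
  by move=> x Dx; apply: (funepos_le _ (mem_set Dx)) => y /set_mem/fg.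
- apply: ge0_le_integral => //; [exact: measurable_funeneg..|].
  by move=> x Dx; apply: (funeneg_le _ (mem_set Dx)) => y /set_mem/fg.
Qed.

(** The inequality log x <= x - 1 at x = exp(-b) / a, multiplied by a. *)
Lemma gibbs_pointwise (R : realType) (a b : R) : 0 <= a ->
  a - a * b - expR (- b) <= a * ln a.
Proof.
rewrite le_eqVlt => /predU1P[<-|a0].
  by rewrite !mul0r subrr sub0r oppr_le0 expR_ge0.
have := expR_ge1Dx (- b - ln a).
rewrite expRD [in expR (- ln a)]expRN lnK ?posrE// ler_pdivlMr//.
by lra.
Qed.

Section gibbs.
Context {R : realType} {X : completeMetricType R}.
Variables (m : {measure set (borelType X) -> \bar R}).

(** Nonnegativity of the entropy relative to the probability with density
    proportional to exp(-phi).  Here exp(-c) normalises exp(-phi), and the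
    pointwise bound is integrated with b = phi + c; its three terms on the
    left have finite integrals, so the integral of rho log rho may be
    infinite without harm. *)
Lemma Ent_ge (mu : probability (borelType X) R) (phi : borelType X -> R) (V c : R) :
  measurable_fun [set: borelType X] phi -> (forall x, 0 <= phi x) ->
  (\int[mu]_(x in [set: X]) (phi x)%:E <= V%:E)%E ->
  (\int[m]_(x in [set: X]) (expR (- phi x))%:E <= (expR c)%:E)%E ->
  ((- (V + c))%:E <= Ent m mu)%E.
Proof.
move=> mphi phi0 phiV Zc; apply: le_ereal_inf_tmp => _ [rho [mrho rho0 rhoE] <-].
have intrho (f : borelType X -> R) : measurable_fun [set: borelType X] f ->
    (forall x, 0 <= f x) ->
    (\int[m]_(x in [set: X]) (f x * rho x)%:E = \int[mu]_(x in [set: X]) (f x)%:E)%E.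
  by move=> mf f0; exact: ge0_integral_density.
have ge0_integrable (f : borelType X -> R) : measurable_fun [set: borelType X] f ->
    (forall x, 0 <= f x) -> (\int[m]_(x in [set: X]) (f x)%:E < +oo)%E ->
    m.-integrable [set: borelType X] (EFin \o f).
  move=> mf f0 fy; apply/integrableP; split; first exact/measurable_EFinP.
  by under eq_integral do rewrite /= ger0_norm//.
have int1 : (\int[m]_(x in [set: X]) (rho x)%:E = 1)%E.
  by rewrite -rhoE// probability_setT.
have irho : m.-integrable [set: borelType X] (EFin \o rho).
  by apply: ge0_integrable => //; rewrite int1 ltry.
pose g x := expR (- phi x) * expR (- c).
have mexp : measurable_fun [set: borelType X] (fun x => expR (- phi x)).
  by apply: measurableT_comp => //; exact: measurableT_comp.
have mg : measurable_fun [set: borelType X] g by exact: measurable_funM.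
have g1 : (\int[m]_(x in [set: X]) (g x)%:E <= 1)%E.
  under eq_integral do rewrite /g EFinM.
  rewrite ge0_integralZr ?lee_fin ?expR_ge0//; last exact/measurable_EFinP.
  rewrite -[leRHS](_ : (expR c)%:E * (expR (- c))%:E = 1)%E; last first.
    by rewrite -EFinM -expRD subrr expR0.
  by rewrite lee_wpmul2r// lee_fin expR_ge0.
have ig : m.-integrable [set: borelType X] (EFin \o g).
  apply: ge0_integrable => //; last by rewrite (le_lt_trans g1)// ltry.
  by move=> x; rewrite mulr_ge0 ?expR_ge0.
have iphirho : m.-integrable [set: borelType X] (EFin \o (fun x => phi x * rho x)).
  apply: ge0_integrable => //; first exact: measurable_funM.
    by move=> x; rewrite mulr_ge0.
  by rewrite intrho// (le_lt_trans phiV)// ltry.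
(* log 0 is 0 here, so the integrand vanishes where rho does *)
have -> : (\int[m]_(x in [set x | (0 < rho x)%R]) (rho x * ln (rho x))%:E =
    \int[m]_(x in [set: X]) (rho x * ln (rho x))%:E)%E.
  rewrite integral_mkcond; apply: eq_integral => x _; rewrite patchE.
  case: ifPn => //; rewrite notin_setE /= => /negP; rewrite -leNgt => x0.
  by rewrite ln0// mulr0.
pose h x := (1 - c) * rho x - (phi x * rho x + g x).
have mphirho : measurable_fun [set: borelType X] (fun x => phi x * rho x).
  exact: measurable_funM.
have mh : measurable_fun [set: borelType X] h.
  apply: measurable_funB; first exact: measurable_funM.
  exact: measurable_funD.
apply: (@le_trans _ _ (\int[m]_(x in [set: X]) (h x)%:E)%E); last first.
  apply: measurable_le_integral => //; first exact/measurable_EFinP.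
    apply/measurable_EFinP; apply: measurable_funM => //.
    exact: measurableT_comp.
  move=> x _; rewrite lee_fin /h.
  have := gibbs_pointwise (phi x + c) (rho0 x).
  by rewrite opprD expRD -/(g x); lra.
have -> : (\int[m]_(x in [set: X]) (h x)%:E =
    (1 - c)%:E - (\int[mu]_(x in [set: X]) (phi x)%:E +
                  \int[m]_(x in [set: X]) (g x)%:E))%E.
  under eq_integral do rewrite /h EFinB.
  rewrite integralB_EFin//; last 2 first.
  - exact: (integrableZl measurableT (1 - c) irho).
  - exact: (integrableD measurableT iphirho ig).
  congr (_ - _)%E.
    under eq_integral do rewrite EFinM.
    by rewrite integralZl// int1 mule1.
  under eq_integral do rewrite EFinD.
  by rewrite integralD_EFin// intrho.
have -> : (- (V + c))%:E = ((1 - c)%:E - (V%:E + 1))%E.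
  by transitivity ((1 - c - (V + 1))%:E) => //; congr EFin; ring.
by rewrite leeB// leeD.
Qed.

End gibbs.

(** * Second moments along Wasserstein geodesics *)

Section wasserstein.
Context {R : realType} {X : completeMetricType R}.
Implicit Types (mu nu : probability (borelType X) R) (z : X).
Local Open Scope ereal_scope.

Lemma coupling_marginal1 mu nu p (f : borelType X -> R) :
  coupling mu nu p -> measurable_fun [set: borelType X] f ->
  (forall x, (0 <= f x)%R) ->
  \int[p]_(xy in [set: X * X]) (f xy.1)%:E = \int[mu]_(x in [set: X]) (f x)%:E.
Proof.
move=> pc mf f0.
rewrite -(@eq_measure_integral _ _ _ setT mu (pushforward p fst)); last first.
  by move=> A mA _; exact: (pc A mA).1.
rewrite ge0_integral_pushforward//; first exact/measurable_EFinP.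
by move=> x _; rewrite lee_fin.
Qed.

Lemma coupling_marginal2 mu nu p (f : borelType X -> R) :
  coupling mu nu p -> measurable_fun [set: borelType X] f ->
  (forall x, (0 <= f x)%R) ->
  \int[p]_(xy in [set: X * X]) (f xy.2)%:E = \int[nu]_(x in [set: X]) (f x)%:E.
Proof.
move=> pc mf f0.
rewrite -(@eq_measure_integral _ _ _ setT nu (pushforward p snd)); last first.
  by move=> A mA _; exact: (pc A mA).2.
rewrite ge0_integral_pushforward//; first exact/measurable_EFinP.
by move=> x _; rewrite lee_fin.
Qed.

Lemma second_moment_ge0 mu z : 0 <= second_moment mu z.
Proof. by apply: integral_ge0 => x _; rewrite lee_fin sqr_ge0. Qed.

Lemma meas_eq_second_moment mu nu z :
  meas_eq mu nu -> second_moment mu z = second_moment nu z.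
Proof. by move=> mn; apply: eq_measure_integral => A mA _; exact: mn. Qed.

Lemma le_integral_lincomb d (T : measurableType d) (p : {measure set T -> \bar R})
    (a b : R) (f g h : T -> R) :
  (0 <= a)%R -> (0 <= b)%R ->
  measurable_fun [set: T] f -> measurable_fun [set: T] g ->
  measurable_fun [set: T] h ->
  (forall x, 0 <= f x)%R -> (forall x, 0 <= g x)%R -> (forall x, 0 <= h x)%R ->
  (forall x, f x <= a * g x + b * h x)%R ->
  \int[p]_x (f x)%:E <= a%:E * \int[p]_x (g x)%:E + b%:E * \int[p]_x (h x)%:E.
Proof.
move=> a0 b0 mf mg mh f0 g0 h0 fgh.
have mag : measurable_fun [set: T] (fun x => (a%:E * (g x)%:E)).
  by apply: emeasurable_funM => //; exact/measurable_EFinP.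
have mbh : measurable_fun [set: T] (fun x => (b%:E * (h x)%:E)).
  by apply: emeasurable_funM => //; exact/measurable_EFinP.
have Ef : measurable_fun [set: T] (fun x => (f x)%:E) by exact/measurable_EFinP.
have Eg : measurable_fun [set: T] (fun x => (g x)%:E) by exact/measurable_EFinP.
have Eh : measurable_fun [set: T] (fun x => (h x)%:E) by exact/measurable_EFinP.
have Eg0 x : [set: T] x -> 0 <= (g x)%:E by rewrite lee_fin.
have Eh0 x : [set: T] x -> 0 <= (h x)%:E by rewrite lee_fin.
rewrite -(ge0_integralZl_EFin p measurableT Eg0 Eg a0).
rewrite -(ge0_integralZl_EFin p measurableT Eh0 Eh b0).
rewrite -(ge0_integralD p measurableT _ mag _ mbh); last 2 first.
- by move=> x _; rewrite lee_fin mulr_ge0.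
- by move=> x _; rewrite lee_fin mulr_ge0.
apply: ge0_le_integral => //; first by move=> x _; rewrite lee_fin.
  exact: emeasurable_funD.
by move=> x _; rewrite lee_fin.
Qed.

Hypothesis sepX : separable X.

(** Integrate the squared triangle inequality d(z,y) <= d(z,x) + d(x,y) against
    the coupling. *)
Lemma second_moment_coupling mu nu p z (k : R) : (0 < k)%R ->
  coupling mu nu p ->
  second_moment nu z <= (1 + k^-1)%:E * second_moment mu z +
    (1 + k)%:E * \int[p]_(xy in [set: X * X]) (mdist (xy.1 : X) (xy.2 : X) ^+ 2)%:E.
Proof.
move=> k0 pc.
rewrite /second_moment -(coupling_marginal2 pc (measurable_mdist_sqr z)); last first.
  by move=> x; rewrite sqr_ge0.
rewrite -(coupling_marginal1 pc (measurable_mdist_sqr z)); last first.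
  by move=> x; rewrite sqr_ge0.
have md2 := measurable_mdist_sqr_prod sepX.
apply: (@le_integral_lincomb _ (borelType X * borelType X)%type p) => //.
- by rewrite addr_ge0 ?invr_ge0// ltW.
- by rewrite addr_ge0// ltW.
- exact: (measurableT_comp (measurable_mdist_sqr z) measurable_snd).
- exact: (measurableT_comp (measurable_mdist_sqr z) measurable_fst).
- by move=> x; rewrite sqr_ge0.
- by move=> x; rewrite sqr_ge0.
- by move=> x; rewrite sqr_ge0.
- by move=> x; exact: mdist_sqr_le.
Qed.

Lemma product_coupling mu nu : exists p, coupling mu nu p.
Proof.
exists (mu \x nu) => A mA; rewrite /pushforward; split.
  rewrite (_ : _ @^-1` _ = A `*` setT); last first.
    by apply/seteqP; split => -[x y] /=; [|case].
  apply: etrans (product_measure1E _ _ mA measurableT) _.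
  by rewrite -[RHS]mule1; congr (_ * _); exact: probability_setT.
rewrite (_ : _ @^-1` _ = setT `*` A); last first.
  by apply/seteqP; split => -[x y] /=; [|case].
apply: etrans (product_measure1E _ _ measurableT mA) _.
by rewrite -[RHS]mul1e; congr (_ * _); exact: probability_setT.
Qed.

Definition transport_cost mu nu : \bar R := ereal_inf
  [set \int[p]_(xy in [set: X * X]) (mdist (xy.1 : X) (xy.2 : X) ^+ 2)%:E |
     p in coupling mu nu].

(** The cost is nonnegative, so the square root in the definition of W2 can be
    undone. *)
Lemma W2_sqr mu nu : W2 mu nu ^+ 2 = transport_cost mu nu.
Proof.
rewrite sqr_sqrte//; apply: le_ereal_inf_tmp => _ [p _ <-].
by apply: integral_ge0 => x _; rewrite lee_fin sqr_ge0.
Qed.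

Lemma second_moment_transport mu nu z (k : R) : (0 < k)%R ->
  second_moment mu z < +oo ->
  second_moment nu z <=
    (1 + k^-1)%:E * second_moment mu z + (1 + k)%:E * transport_cost mu nu.
Proof.
move=> k0 muy.
have mufin : second_moment mu z \is a fin_num.
  by rewrite ge0_fin_numE// second_moment_ge0.
rewrite -leeBlDl; last by rewrite fin_numM.
have k1 : (0 < 1 + k)%R by rewrite addr_gt0.
rewrite [leRHS]muleC -lee_pdivrMr//; apply: le_ereal_inf_tmp => _ [p pc <-].
rewrite lee_pdivrMr// [leRHS]muleC leeBlDl; last by rewrite fin_numM.
exact: second_moment_coupling.
Qed.

(** Bound the cost by that of the product coupling. *)
Lemma transport_cost_le mu nu z (k : R) : (0 < k)%R ->
  transport_cost mu nu <=
    (1 + k^-1)%:E * second_moment mu z + (1 + k)%:E * second_moment nu z.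
Proof.
move=> k0; have [p pc] := product_coupling mu nu.
apply: le_trans (ereal_inf_lbound _) _; first by exists p.
rewrite /second_moment -(coupling_marginal2 pc (measurable_mdist_sqr z)); last first.
  by move=> x; rewrite sqr_ge0.
rewrite -(coupling_marginal1 pc (measurable_mdist_sqr z)); last first.
  by move=> x; rewrite sqr_ge0.
have md2 := measurable_mdist_sqr_prod sepX.
apply: (@le_integral_lincomb _ (borelType X * borelType X)%type p) => //.
- by rewrite addr_ge0 ?invr_ge0// ltW.
- by rewrite addr_ge0// ltW.
- exact: (measurableT_comp (measurable_mdist_sqr z) measurable_fst).
- exact: (measurableT_comp (measurable_mdist_sqr z) measurable_snd).
- by move=> x; rewrite sqr_ge0.
- by move=> x; rewrite sqr_ge0.
- by move=> x; rewrite sqr_ge0.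
- move=> x; rewrite (metric_sym z x.1); exact: mdist_sqr_le.
Qed.

(** Here e bounds the second moment of the starting point.  When it tends to 0,
    and then k does, the bound becomes t^2 V: the estimate that is exact for a
    geodesic starting at the Dirac mass at z. *)
Lemma geodesic_second_moment (mu_ : R -> probability (borelType X) R) z
    (k e V t : R) :
  W2_geodesic mu_ -> (0 < k)%R -> t \in `[0%R, 1%R] ->
  second_moment (mu_ 0%R) z <= e%:E -> second_moment (mu_ 1%R) z <= V%:E ->
  second_moment (mu_ t) z <=
    ((1 + k^-1) * e + (1 + k) * (t ^+ 2 * ((1 + k^-1) * e + (1 + k) * V)))%:E.
Proof.
move=> [_ geo] k0 t01 m0e m1V.
have k1 : (0 <= 1 + k^-1)%R by rewrite addr_ge0// invr_ge0 ltW.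
have k2 : (0 <= 1 + k)%R by rewrite addr_ge0// ltW.
have costt : transport_cost (mu_ 0%R) (mu_ t) =
    (t ^+ 2)%:E * transport_cost (mu_ 0%R) (mu_ 1%R).
  rewrite -!W2_sqr geo//; last by rewrite in_itv/= lexx ler01.
  by rewrite sub0r normrN !expe2 muleACA -EFinM -expr2 real_normK ?num_real.
apply: (le_trans (second_moment_transport (mu_ t) k0 (le_lt_trans m0e (ltry e)))).
rewrite [leRHS]EFinD leeD//.
  by rewrite [leRHS]EFinM lee_wpmul2l ?lee_fin.
rewrite [leRHS]EFinM lee_wpmul2l ?lee_fin// costt [leRHS]EFinM lee_wpmul2l ?lee_fin ?sqr_ge0//.
apply: (le_trans (transport_cost_le _ _ z k0)).
by rewrite [leRHS]EFinD !EFinM leeD// lee_wpmul2l ?lee_fin.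
Qed.

End wasserstein.

(** * The Gamma function at half-integers *)

Section gamma.
Context {R : realType}.
Local Notation mu := (@lebesgue_measure R).

Lemma integral_expRN (c a : R) : 0 < c ->
  (\int[mu]_(u in `[a, +oo[) (expR (- (c * u)))%:E = (c^-1 * expR (- (c * a)))%:E)%E.
Proof.
move=> c0.
have dF (x : R) : is_derive x 1 (fun u => - (c^-1 * expR (- (c * u))) : R) (expR (- (c * x))).
  apply: is_derive_eq; rewrite /GRing.scale/=; field; exact: lt0r_neq0.
have cexp : continuous (fun u : R => expR (- (c * u))).
  move=> x; apply: continuous_comp; last exact: continuous_expR.
  by apply: continuousN; apply: continuousM; [exact: cvg_cst|exact: cvg_id].
rewrite (@ge0_continuous_FTC2y _ _ (fun u => - (c^-1 * expR (- (c * u)))) _ 0)//.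
- by rewrite sub0e -EFinN opprK.
- exact: continuous_subspaceT.
- rewrite -oppr0; apply: cvgN; rewrite -(mulr0 c^-1); apply: cvgM; first exact: cvg_cst.
  apply: (@cvg_comp _ _ _ (fun u => c * u) (fun u => expR (- u)) _ (pinfty_nbhs R)); last exact: cvgr_expR.
  exact: gt0_cvgMry.
- apply: cvg_at_right_filter; apply: cvgN.
  by apply: cvgM; [exact: cvg_cst|exact: cexp].
- by move=> x _; rewrite derive1E; have [_ ->] := dF x.
Qed.

Lemma exprn_le_expR (n : nat) (x : R) : 0 <= x -> x ^+ n <= n`!%:R * expR x.
Proof.
move=> x0; case: n => [|n].
  by rewrite expr0 fact0 mul1r -[leLHS](@expR0 R) ler_expR.
rewrite mulrC -ler_pdivrMr ?ltr0n ?fact_gt0//.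
by apply: le_trans (expR_ge1Dxn n x0); rewrite lerDr.
Qed.

Lemma powR_half (N : nat) (t : R) : 0 <= t ->
  t `^ (N%:R / 2) = Num.sqrt t ^+ N.
Proof.
by move=> t0; rewrite mulrC powRrM powR12_sqrt// powR_mulrn// sqrtr_ge0.
Qed.

(** sqrt(t)^N <= 1 + t^N, and half of the exponential absorbs t^N; this makes
    the integral defining Gamma finite. *)
Lemma powR_half_exp_le (N : nat) (t : R) : 0 < t ->
  t `^ (N%:R / 2) * expR (- t) <=
    (1 + N`!%:R * 2 ^+ N) * expR (- (2^-1 * t)).
Proof.
move=> t0.
have half : expR (- t) = expR (- (2^-1 * t)) * expR (- (2^-1 * t)).
  by rewrite -expRD; congr expR; field.
rewrite half mulrA ler_pM2r ?expR_gt0// expRN ler_pdivrMr ?expR_gt0//.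
have s1 : Num.sqrt t ^+ N <= 1 + t ^+ N.
  have [s1|s1] := leP (Num.sqrt t) 1.
    rewrite (le_trans (exprn_ile1 _ (sqrtr_ge0 _) s1))// lerDl.
    by rewrite exprn_ge0// ltW.
  apply: (@le_trans _ _ (t ^+ N)); last by rewrite lerDr.
  have st : Num.sqrt t <= t.
    rewrite -[X in _ <= X](sqr_sqrtr (ltW t0)) expr2.
    by rewrite ler_peMl ?sqrtr_ge0// ltW.
  by rewrite lerXn2r// nnegrE ?sqrtr_ge0// ltW.
rewrite powR_half; last exact: ltW.
rewrite (le_trans s1)// mulrDl mul1r lerD//.
  by rewrite -[leLHS](@expR0 R) ler_expR mulr_ge0// ltW.
rewrite mulrAC -ler_pdivrMr ?exprn_gt0//.
rewrite mulrC -exprVn -exprMn exprn_le_expR//.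
by rewrite mulr_ge0// ltW.
Qed.

(** Gamma is the real value of an extended integral, hence 0 if that integral
    diverges: only convergence makes Gamma equal to the integral. *)
Lemma Gamma_half (N : nat) :
  0 < Gamma (N%:R / 2 + 1) :> R /\
  (\int[mu]_(t in `]0%R, +oo[) (t `^ (N%:R / 2) * expR (- t))%:E =
    (Gamma (N%:R / 2 + 1))%:E)%E.
Proof.
pose f (t : R) := t `^ (N%:R / 2) * expR (- t).
have mf : measurable_fun [set: R] f.
  apply: measurable_funM; first exact: measurable_powR.
  by apply: measurableT_comp => //; exact: measurableT_comp.
have mexp (c : R) : measurable_fun [set: R] (fun t : R => expR (- (c * t))).
  apply: measurableT_comp => //; apply: measurableT_comp => //.
have f0 t : 0 <= f t by rewrite mulr_ge0 ?powR_ge0 ?expR_ge0.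
have mEf D : measurable D -> measurable_fun D (fun t => (f t)%:E).
  by move=> mD; apply: measurable_funTS; exact/measurable_EFinP.
have mEexp c D : measurable D ->
    measurable_fun D (fun t : R => (expR (- (c * t)))%:E).
  by move=> mD; apply: measurable_funTS; exact/measurable_EFinP.
have fy : (\int[mu]_(t in `]0%R, +oo[) (f t)%:E < +oo)%E.
  pose C : R := 1 + N`!%:R * 2 ^+ N.
  have C0 : 0 <= C by rewrite addr_ge0// mulr_ge0// exprn_ge0.
  apply: (@le_lt_trans _ _ (\int[mu]_(t in `]0%R, +oo[)
      (C%:E * (expR (- (2^-1 * t)))%:E))%E).
    apply: ge0_le_integral => //; try by move=> t _; rewrite lee_fin.
    - exact: mEf.
    - by apply: emeasurable_funM => //; exact: mEexp.
    - move=> t; rewrite /= in_itv/= andbT => t0.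
      by rewrite lee_fin powR_half_exp_le.
  rewrite ge0_integralZl//; try by move=> t _; rewrite lee_fin expR_ge0.
    apply: (@le_lt_trans _ _ (C%:E * \int[mu]_(t in `[0%R, +oo[)
        (expR (- (2^-1 * t)))%:E)%E); last first.
      by rewrite integral_expRN// -EFinM ltry.
    rewrite lee_wpmul2l ?lee_fin//; apply: ge0_subset_integral => //.
    - exact: mEexp.
    - by apply: subset_itvr; rewrite bnd_simp.
  exact: mEexp.
have fpos : (0 < \int[mu]_(t in `]0%R, +oo[) (f t)%:E)%E.
  apply: (@lt_le_trans _ _ (\int[mu]_(t in `[1%R, +oo[) (expR (- (1 * t)))%:E)%E).
    by rewrite integral_expRN// lte_fin mulr_gt0 ?expR_gt0// invr_gt0.
  apply: (@le_trans _ _ (\int[mu]_(t in `[1%R, +oo[) (f t)%:E)%E).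
    apply: ge0_le_integral => //; try by move=> t _; rewrite lee_fin expR_ge0.
    - exact: mEexp.
    - exact: mEf.
    - move=> t; rewrite /= in_itv/= andbT => t1; rewrite lee_fin /f mul1r.
      rewrite ler_peMl ?expR_ge0// powR_half ?(le_trans ler01)//.
      by rewrite exprn_ege1// -[leLHS]sqrtr1 ler_wsqrtr.
  apply: ge0_subset_integral => //.
  - exact: mEf.
  - by move=> t _; rewrite lee_fin.
  - by apply: subset_itvr; rewrite bnd_simp.
have GE : (\int[mu]_(t in `]0%R, +oo[) (f t)%:E)%E =
    (Gamma (N%:R / 2 + 1))%:E.
  by rewrite /Gamma addrK /Rintegral fineK// ge0_fin_numE// ltW.
by split => //; move: fpos; rewrite GE lte_fin.
Qed.

Lemma unit_ball_volume_gt0 (N : nat) : 0 < unit_ball_volume N :> R.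
Proof.
by rewrite divr_gt0// ?powR_gt0 ?pi_gt0//; have [] := Gamma_half N.
Qed.

End gamma.

(** * Gaussian mass of a ball *)

Section gaussian_mass.
Context {R : realType} {X : completeMetricType R}.
Variable m : {measure set (borelType X) -> \bar R}.
Local Notation leb := (@lebesgue_measure R).

(** The normalised restriction of m to B serves twice: as a probability measure
    to which Tonelli's theorem applies on B, and as the starting point of the
    geodesic. *)
Lemma exists_uniform_probability (B : set (borelType X)) : measurable B ->
  (0 < m B)%E -> (m B < +oo)%E ->
  exists mu : probability (borelType X) R,
    (forall A, measurable A -> m (A `&` B) = m B * mu A)%E /\
    is_density m mu (fun x => \1_B x / fine (m B)).
Proof.
move=> mB B0 By.
have Bfin : m B \is a fin_num by rewrite ge0_fin_numE.
have fB0 : 0 < fine (m B) by rewrite fine_gt0// B0.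
have [mu muE] : exists mu : probability (borelType X) R,
    forall A, mu A = (m (A `&` B) * (fine (m B))^-1%:E)%E.
  exists (mnormalize (mrestr m mB) (dirac point)) => A /=.
  rewrite /mnormalize/= (_ : mrestr m mB [set: borelType X] = m B); last first.
    by rewrite /mrestr setTI.
  rewrite gt_eqF//=.
  by rewrite (_ : (m B == +oo%E) = false)// lt_eqF.
exists mu.
split=> [A mA|].
  by rewrite muE muleCA -{1}(fineK Bfin) -EFinM divff ?mule1// gt_eqF.
split.
- by apply: measurable_funM => //; exact: measurable_indic.
- by move=> x; rewrite mulr_ge0// invr_ge0 ltW.
- move=> A mA; rewrite muE.
  under eq_integral do rewrite EFinM.
  rewrite ge0_integralZr//.
  + by rewrite integral_indic// setIC.
  + by apply: measurable_funTS; exact/measurable_EFinP/measurable_indic.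
Qed.

Lemma integral_over_uniform (B : set (borelType X))
    (mu : probability (borelType X) R) (f : borelType X -> R) :
  measurable B -> (0 < m B)%E -> (m B < +oo)%E ->
  is_density m mu (fun x => \1_B x / fine (m B)) ->
  measurable_fun [set: borelType X] f -> (forall x, 0 <= f x) ->
  (\int[m]_(x in B) (f x)%:E = m B * \int[mu]_(x in [set: X]) (f x)%:E)%E.
Proof.
move=> mB B0 By [mrho rho0 rhoE] mf f0.
have Bfin : m B \is a fin_num by rewrite ge0_fin_numE.
have fB0 : 0 < fine (m B) by rewrite fine_gt0// B0.
rewrite -(ge0_integral_density mrho rho0 rhoE mf f0) -{1}(fineK Bfin).
rewrite -ge0_integralZl ?lee_fin ?(ltW fB0)//.
- rewrite [LHS]integral_mkcond; apply: eq_integral => x _.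
  rewrite patchE indicE; case: ifP => _; rewrite -EFinM; congr EFin.
    by rewrite mul1r mulrCA divff ?mulr1// gt_eqF.
  by rewrite !(mul0r, mulr0).
- by apply/measurable_EFinP; exact: measurable_funM.
- by move=> x _; rewrite lee_fin mulr_ge0.
Qed.

Lemma measurable_sublevel (phi : borelType X -> R) (u : R) :
  measurable_fun [set: borelType X] phi ->
  measurable [set x : borelType X | phi x <= u].
Proof.
move=> mphi; rewrite (_ : [set x | _] = setT `&` phi @^-1` `]-oo, u]%classic).
  by apply: mphi => //; exact: measurable_itv.
by rewrite setTI; apply/seteqP; split => x /=; rewrite in_itv.
Qed.

(** Write exp(-phi) as the integral of exp(-u) over u >= phi and exchange the
    integrals. *)
Lemma layer_cake_expRN (mu : probability (borelType X) R) (phi : borelType X -> R) :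
  measurable_fun [set: borelType X] phi -> (forall x, 0 <= phi x) ->
  (\int[mu]_(x in [set: X]) (expR (- phi x))%:E =
   \int[leb]_(u in `[0%R, +oo[) ((expR (- u))%:E * mu [set x | (phi x <= u)%R]))%E.
Proof.
move=> mphi phi0.
pose G (p : borelType X * measurableTypeR R) : \bar R :=
  (\1_[set p : borelType X * measurableTypeR R | (phi p.1 <= p.2)%R] p * expR (- p.2))%:E.
have mset : measurable [set p : borelType X * measurableTypeR R | (phi p.1 <= p.2)%R].
  have : measurable_fun setT (fun p : borelType X * measurableTypeR R => (phi p.1 <= p.2)%R).
    apply: measurable_fun_ler => //.
    exact: (measurableT_comp mphi measurable_fst).
  by move=> /(_ measurableT [set true]); rewrite setTI; exact.
have mG : measurable_fun setT G.
  apply/measurable_EFinP; apply: measurable_funM; first exact: measurable_indic.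
  by apply: measurableT_comp => //; apply: measurableT_comp.
have G0 p : (0 <= G p)%E by rewrite lee_fin mulr_ge0// expR_ge0.
transitivity (\int[mu]_(x in [set: X]) \int[leb]_u G (x, u))%E.
  apply: eq_integral => x _.
  have := integral_expRN (phi x) (@ltr01 R); rewrite invr1 !mul1r => <-.
  rewrite integral_mkcond; apply: eq_integral => u _.
  rewrite /G patchE indicE /=; case: ifPn => xu.
    by rewrite mem_set ?mul1r ?mul1r//; move: xu; rewrite inE/= in_itv/= andbT.
  rewrite memNset ?mul0r// => xu'; move: xu => /negP; apply.
  by rewrite inE/= in_itv/= andbT.
rewrite (@fubini_tonelli _ _ (borelType X) (measurableTypeR R) _ mu leb G)//.
rewrite [in RHS]integral_mkcond; apply: eq_integral => u _.
have mu_set := measurable_sublevel u mphi.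
transitivity ((expR (- u))%:E * mu [set x | (phi x <= u)%R])%E.
  rewrite -(setIT [set x | (phi x <= u)%R]) -integral_indic//.
  rewrite -ge0_integralZl//; last exact/measurable_EFinP/measurable_indic.
  by apply: eq_integral => x _; rewrite /G -EFinM mulrC !indicE.
rewrite patchE; case: ifPn => // u0.
rewrite (_ : [set x | _] = set0) ?measure0 ?mule0//.
rewrite -subset0 => x /= xu; move: u0 => /negP; apply.
by rewrite inE/= in_itv/= andbT (le_trans (phi0 x)).
Qed.

Variables (N : nat) (z : X) (r0 eta : R).
Hypotheses (r0_gt0 : 0 < r0) (eta_ge0 : 0 <= eta).
Hypothesis ball_le : forall r, 0 < r <= r0 ->
  (m (cball z r) <= ((1 + eta) * (unit_ball_volume N * r ^+ N))%:E)%E.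
Hypothesis ball_gt0 : (0 < m (cball z r0))%E.

(** By the layer-cake formula the mass is the integral over u of exp(-u) times
    the measure of the ball of radius sqrt(2 s^2 u), cut off at r0.  The volume
    bound turns it into w (2 s^2)^(N/2) times the integral of
    u^(N/2) exp(-u), that is Gamma(N/2 + 1), the factor that the volume of
    the unit ball w = pi^(N/2) / Gamma(N/2 + 1) cancels. *)
Lemma gaussian_mass_ball (s : R) : 0 < s ->
  (\int[m]_(x in cball z r0) (expR (- (mdist z x ^+ 2 / (2 * s ^+ 2))))%:E <=
    ((1 + eta) * (2 * pi * s ^+ 2) `^ (N%:R / 2))%:E)%E.
Proof.
move=> s0.
pose phi (x : borelType X) : R := mdist z x ^+ 2 / (2 * s ^+ 2).
have ss0 : 0 < 2 * s ^+ 2 by rewrite mulr_gt0// exprn_gt0.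
have phi0 x : 0 <= phi x by rewrite divr_ge0 ?sqr_ge0// ltW.
have mphi : measurable_fun [set: borelType X] phi.
  by apply: measurable_funM => //; exact: measurable_mdist_sqr.
have mexp : measurable_fun [set: borelType X] (fun x => expR (- phi x)).
  by apply: measurableT_comp => //; exact: measurableT_comp.
have mB : measurable (cball z r0 : set (borelType X)) by exact: cball_measurable.
have By : (m (cball z r0) < +oo)%E.
  by apply: (le_lt_trans (ball_le _)); rewrite ?r0_gt0 ?lexx ?ltry.
have [mu [muE mudens]] := exists_uniform_probability mB ball_gt0 By.
rewrite (integral_over_uniform mB ball_gt0 By mudens mexp)//.
rewrite layer_cake_expRN//.
pose A (u : R) := [set x : borelType X | phi x <= u].
have mA u : measurable (A u) by exact: measurable_sublevel.
have mmuA : measurable_fun [set: R] (fun u => mu (A u)).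
  rewrite (_ : (fun u => _) = (fun u => (fine (mu (A u)))%:E)); last first.
    by apply/funext => u; rewrite fineK// fin_num_measure.
  apply/measurable_EFinP; apply: nondecreasing_measurable => // u v uv.
  rewrite fine_le ?fin_num_measure// le_measure ?inE//.
  by move=> x /=; rewrite /A /= => /le_trans; apply.
have mexpmu : measurable_fun [set: R] (fun u => (expR (- u))%:E * mu (A u))%E.
  apply: emeasurable_funM => //; apply/measurable_EFinP.
  by apply: measurableT_comp.
rewrite -integral_itv_obnd_cbnd; last exact: measurable_funTS.
have Bfin : m (cball z r0) \is a fin_num by rewrite ge0_fin_numE.
rewrite -(fineK Bfin); set b := fine _.
have b0 : 0 < b by rewrite fine_gt0// ball_gt0.
have w0 := unit_ball_volume_gt0 N (R := R).
pose K := (1 + eta) * (unit_ball_volume N * Num.sqrt (2 * s ^+ 2) ^+ N) / b.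
have K0 : 0 <= K.
  rewrite divr_ge0 ?(ltW b0)// mulr_ge0 ?addr_ge0//.
  by rewrite mulr_ge0 ?exprn_ge0 ?sqrtr_ge0 ?(ltW w0).
have muA u : 0 < u -> (mu (A u) <= (K * Num.sqrt u ^+ N)%:E)%E.
  move=> u0; pose r := Num.min r0 (Num.sqrt (2 * s ^+ 2) * Num.sqrt u).
  have rpos : 0 < r by rewrite lt_min r0_gt0 mulr_gt0 ?sqrtr_gt0.
  have : (m (A u `&` cball z r0) <= m (cball z r))%E.
    apply: le_measure; rewrite ?inE//; first exact: measurableI.
      exact: cball_measurable.
    move=> x [xu xB]; rewrite /cball/= le_min xB -sqrtrM ?(ltW ss0)//=.
    rewrite -[leLHS]ger0_norm ?mdist_ge0// -sqrtr_sqr ler_wsqrtr//.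
    by move: xu; rewrite /A /= /phi ler_pdivrMr// mulrC.
  rewrite muE// -(fineK Bfin) -/b => /le_trans/(_ (ball_le _)).
  rewrite rpos ge_min lexx => /(_ isT).
  rewrite muleC -lee_pdivlMr// -EFinM => /le_trans; apply.
  rewrite lee_fin /K [leRHS]mulrAC ler_pM2r ?invr_gt0//.
  rewrite -[leRHS]mulrA ler_pM2l; last by rewrite ltr_wpDr.
  rewrite -[leRHS]mulrA ler_pM2l// -exprMn lerXn2r ?nnegrE ?(ltW rpos)//.
    by rewrite ge_min lexx orbT.
have [G0 GE] := Gamma_half N (R := R).
apply: (@le_trans _ _ (b%:E * \int[leb]_(u in `]0%R, +oo[)
    (K%:E * (u `^ (N%:R / 2) * expR (- u))%:E))%E).
  rewrite lee_pmul2l//; apply: ge0_le_integral => //.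
  - by move=> u _; rewrite mule_ge0 ?lee_fin ?expR_ge0.
  - exact: measurable_funTS.
  - apply: measurable_funTS; apply: emeasurable_funM => //.
    apply/measurable_EFinP; apply: measurable_funM; first exact: measurable_powR.
    by apply: measurableT_comp.
  - move=> u; rewrite /= in_itv/= andbT => u0.
    rewrite -EFinM mulrA mulrC EFinM lee_wpmul2l ?lee_fin ?expR_ge0//.
    by rewrite powR_half ?(ltW u0)//; exact: muA.
have mEgam : measurable_fun (`]0, +oo[%classic : set R)
    (fun u : R => (u `^ (N%:R / 2) * expR (- u))%:E).
  apply: measurable_funTS; apply/measurable_EFinP.
  apply: measurable_funM; first exact: measurable_powR.
  by apply: measurableT_comp.
have Egam0 (u : R) : (`]0, +oo[%classic : set R) u -> (0 <= (u `^ (N%:R / 2) * expR (- u))%:E)%E.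
  by rewrite lee_fin mulr_ge0 ?powR_ge0 ?expR_ge0.
have -> : (\int[leb]_(u in `]0%R, +oo[)
    (K%:E * (u `^ (N%:R / 2) * expR (- u))%:E) = (K * Gamma (N%:R / 2 + 1))%:E)%E.
  transitivity (K%:E * (Gamma (N%:R / 2 + 1))%:E)%E; last by rewrite EFinM.
  rewrite -[X in (_ * X)%E]GE.
  exact: (ge0_integralZl_EFin leb (measurable_itv _) Egam0 mEgam K0).
rewrite -!EFinM lee_fin /K.
rewrite -powR_half ?(ltW ss0)// /unit_ball_volume.
have -> : 2 * pi * s ^+ 2 = pi * (2 * s ^+ 2) :> R by ring.
rewrite (@powRM _ pi (2 * s ^+ 2)) ?pi_ge0 ?(ltW ss0)//.
rewrite le_eqVlt; apply/orP; left; apply/eqP.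
by field; rewrite !gt_eqF.
Qed.

End gaussian_mass.

(** * Gaussian mass and concentrated measures on metric measure spaces *)

Section metric_measure.
Context {R : realType} {X : completeMetricType R}.
Variable m : {measure set (borelType X) -> \bar R}.
Hypothesis mms : metric_measure_space m.

Lemma measurable_expRN_mdist_sqr (z : X) (a : R) :
  measurable_fun [set: borelType X]
    (fun x : borelType X => (expR (- (a * mdist z x ^+ 2)))%:E).
Proof.
apply/measurable_EFinP; apply: measurableT_comp => //.
apply: measurableT_comp => //; apply: measurable_funM => //.
exact: measurable_mdist_sqr.
Qed.

Lemma cball_measure_gt0 (z : X) (r : R) : 0 < r -> (0 < m (cball z r))%E.
Proof.
move=> r0; have [_ _ ms _] := mms.
have : msupp m z by rewrite ms.
move=> /(_ [set y | mdist z y < r]); move=> /(_ _)/lt_le_trans; apply.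
  by split; [exact: open_mdist_lt|rewrite /= mdistxx].
apply: le_measure; rewrite ?inE//.
- by apply: open_borel; exact: open_mdist_lt.
- exact: cball_measurable.
- by move=> y /= /ltW.
Qed.

(** The growth condition can be centred at any point, since
    d(x0,x)^2 <= 2 d(x0,z)^2 + 2 d(z,x)^2. *)
Lemma gaussian_integrable (z : X) : exists C K : R, 0 < C /\ 0 <= K /\
  (\int[m]_(x in [set: X]) (expR (- (C * mdist z x ^+ 2)))%:E <= K%:E)%E.
Proof.
have [_ _ _ [C [x0 [C0 Cy]]]] := mms.
pose I := (\int[m]_(x in [set: X]) (expR (- C * mdist x0 x ^+ 2))%:E)%E.
have I0 : (0 <= I)%E by apply: integral_ge0 => x _; rewrite lee_fin expR_ge0.
have Ifin : I \is a fin_num by rewrite ge0_fin_numE.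
exists (2 * C), (expR (2 * C * mdist x0 z ^+ 2) * fine I); split.
  by rewrite mulr_gt0.
split; first by rewrite mulr_ge0 ?expR_ge0 ?fine_ge0.
rewrite EFinM fineK// /I.
rewrite -ge0_integralZl ?lee_fin ?expR_ge0//.
  apply: ge0_le_integral => //.
  - exact: measurable_expRN_mdist_sqr.
  - apply: emeasurable_funM => //; under eq_fun do rewrite mulNr.
    exact: measurable_expRN_mdist_sqr.
  - move=> x _; rewrite -EFinM lee_fin -expRD ler_expR.
    have := mdist_sqr_le x0 z x (@ltr01 R); rewrite invr1.
    by move=> h; have := ler_wpM2l (ltW C0) h; lra.
under eq_fun do rewrite mulNr.
exact: measurable_expRN_mdist_sqr.
Qed.

(** The Gibbs inequality with phi = C d(z,.)^2, where exp(-phi) is integrable. *)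
Lemma Ent_gtNy (mu : probability (borelType X) R) (z : X) :
  (second_moment mu z < +oo)%E -> (-oo < Ent m mu)%E.
Proof.
move=> muy; have [C [K [C0 [K0 CK]]]] := gaussian_integrable z.
have mufin : second_moment mu z \is a fin_num.
  by rewrite ge0_fin_numE// second_moment_ge0.
apply: (@lt_le_trans _ _ (- (C * fine (second_moment mu z) + ln (K + 1)))%:E).
  exact: ltNyr.
apply: (@Ent_ge _ _ m mu (fun x => C * mdist z x ^+ 2)) => //.
- by apply: measurable_funM => //; exact: measurable_mdist_sqr.
- by move=> x; rewrite mulr_ge0 ?sqr_ge0// ltW.
- under eq_integral do rewrite EFinM.
  rewrite ge0_integralZl ?lee_fin ?(ltW C0)//.
  + by rewrite EFinM fineK.
  + by apply/measurable_EFinP; exact: measurable_mdist_sqr.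
  + by move=> x _; rewrite lee_fin sqr_ge0.
- rewrite (le_trans CK)// lnK ?posrE ?ltr_wpDl// lee_fin lerDl//.
Qed.

(** The uniform probability on a small ball around z: its density is constant on
    the ball, so its entropy is finite. *)
Lemma exists_concentrated_measure (z : X) (e : R) : 0 < e ->
  exists mu : probability (borelType X) R,
    (second_moment mu z <= e%:E)%E /\ Ent m mu \is a fin_num.
Proof.
move=> e0; have [_ lf _ _] := mms.
have [U [oU Uz] mU] := lf z.
have /nbhs_ballP[r1 /= r10 r1U] : nbhs z U by exact: open_nbhs_nbhs.
pose r := Num.min (r1 / 2) (Num.sqrt e).
have r0 : 0 < r by rewrite lt_min divr_gt0// sqrtr_gt0.
pose B : set (borelType X) := cball z r.
have mB : measurable B by exact: cball_measurable.
have BU : B `<=` U.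
  move=> x zx; apply: r1U; rewrite ballEmdist/=; move: zx; rewrite /B /cball/=.
  by rewrite le_min => /andP[zx _]; lra.
have By : (m B < +oo)%E.
  apply: le_lt_trans mU; apply: le_measure; rewrite ?inE//.
  exact: open_borel.
have B0 : (0 < m B)%E by exact: cball_measure_gt0.
have Bfin : m B \is a fin_num by rewrite ge0_fin_numE.
have fB0 : 0 < fine (m B) by rewrite fine_gt0// B0.
have [mu [muE mudens]] := exists_uniform_probability mB B0 By.
have mue : (second_moment mu z <= e%:E)%E.
  have := integral_over_uniform mB B0 By mudens (measurable_mdist_sqr z).
  move=> /(_ (fun x => sqr_ge0 _)) intE.
  have : (m B * second_moment mu z <= m B * e%:E)%E.
    rewrite -intE muleC -(integral_cst _ mB).
    apply: ge0_le_integral => //.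
    - by move=> x _; rewrite lee_fin sqr_ge0.
    - apply: measurable_funTS; apply/measurable_EFinP.
      exact: measurable_mdist_sqr.
    - move=> x; rewrite /B /cball/= le_min => /andP[_ xe].
      rewrite lee_fin -(sqr_sqrtr (ltW e0)) lerXn2r ?nnegrE ?mdist_ge0//.
  by rewrite lee_pmul2l.
exists mu; split => //.
rewrite fin_real// (@Ent_gtNy _ z) ?(le_lt_trans mue) ?ltry//=.
apply: le_lt_trans (ereal_inf_lbound _) _; first by exists (fun x => \1_B x / fine (m B)).
rewrite (_ : [set x | _] = B); last first.
  apply/seteqP; split => x /=; rewrite indicE; last first.
    by move=> Bx; rewrite mem_set// divr_gt0.
  by have [/set_mem|] := boolP (x \in B); rewrite ?mul0r ?ltxx.
rewrite (eq_integral (cst ((fine (m B))^-1 * ln (fine (m B))^-1)%:E)); last first.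
  by move=> x Bx /=; rewrite indicE Bx mul1r.
by rewrite integral_cst// -(fineK Bfin) -EFinM ltry.
Qed.

(** For small s, the integrand outside the ball of radius r0 is at most
    exp(C r0^2 - r0^2 / (2 s^2)) exp(-C d^2), whose integral decays faster than
    any power of s; the second eta absorbs it. *)
Lemma gaussian_mass_le (N : nat) (z : X) (r0 eta : R) :
  (0 < N)%N -> 0 < r0 -> 0 < eta ->
  (forall r, 0 < r <= r0 ->
    (m (cball z r) <= ((1 + eta) * (unit_ball_volume N * r ^+ N))%:E)%E) ->
  exists s0, 0 < s0 /\ forall s, 0 < s <= s0 ->
    (\int[m]_(x in [set: X]) (expR (- (mdist z x ^+ 2 / (2 * s ^+ 2))))%:E <=
      ((1 + eta + eta) * (2 * pi * s ^+ 2) `^ (N%:R / 2))%:E)%E.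
Proof.
move=> N0 r00 eta0 ball_le.
have ball_gt0 : (0 < m (cball z r0))%E by exact: cball_measure_gt0.
have [C [K [C0 [K0 CK]]]] := gaussian_integrable z.
pose D := K * expR (C * r0 ^+ 2) * N`!%:R * (2 / r0 ^+ 2) ^+ N.
have D0 : 0 <= D.
  by rewrite !mulr_ge0 ?expR_ge0 ?exprn_ge0// divr_ge0// sqr_ge0.
pose E := eta * Num.sqrt (2 * pi) ^+ N.
have p0 : 0 < 2 * pi :> R by rewrite mulr_gt0// pi_gt0.
have E0 : 0 < E by rewrite mulr_gt0// exprn_gt0// sqrtr_gt0.
(* s <= 1 gives s^N <= s; then (2 C)^-1 makes the exponent comparison valid,
   and E / (D + 1) lets the tail D s^(2 N) be at most E s^N *)
exists (Num.min 1 (Num.min (2 * C)^-1 (E / (D + 1)))); split.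
  by rewrite !lt_min ltr01 invr_gt0 mulr_gt0// divr_gt0// ltr_wpDl.
move=> s /andP[s0]; rewrite !le_min => /and3P[s1 sC sE].
have mB : measurable (cball z r0 : set (borelType X)) by exact: cball_measurable.
have ss0 : 0 < 2 * s ^+ 2 by rewrite mulr_gt0// exprn_gt0.
have mg : measurable_fun [set: borelType X]
    (fun x : borelType X => (expR (- (mdist z x ^+ 2 / (2 * s ^+ 2))))%:E).
  by under eq_fun do rewrite mulrC; exact: measurable_expRN_mdist_sqr.
pose g (x : borelType X) := (expR (- (mdist z x ^+ 2 / (2 * s ^+ 2))))%:E.
have g0 x : (0 <= g x)%E by rewrite lee_fin expR_ge0.
have mBC : measurable (~` cball z r0 : set (borelType X)) by exact: measurableC.
have split_int : (\int[m]_(x in [set: X]) g x =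
    \int[m]_(x in cball z r0) g x + \int[m]_(x in ~` cball z r0) g x)%E.
  rewrite -[LHS](_ : \int[m]_(x in cball z r0 `|` ~` cball z r0) g x = _)%E; last first.
    by rewrite setUv.
  rewrite ge0_integral_setU//; first by rewrite setUv.
  exact/disj_setPCl.
rewrite split_int mulrDl EFinD leeD//.
  by apply: gaussian_mass_ball => //; exact: ltW.
pose y := r0 ^+ 2 / (2 * s ^+ 2).
have y0 : 0 < y by rewrite divr_gt0// exprn_gt0.
have Cs : C <= (2 * s ^+ 2)^-1.
  rewrite -(invrK C) lef_pV2 ?posrE ?invr_gt0//.
  have : s ^+ 2 <= s by rewrite expr2 ler_piMl// ltW.
  by move: sC; rewrite invfM; lra.
pose T := expR (C * r0 ^+ 2 - y).
apply: (@le_trans _ _ (T * K)%:E).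
  apply: (@le_trans _ _ (\int[m]_(x in [set: X])
      (T%:E * (expR (- (C * mdist z x ^+ 2)))%:E))%E); last first.
    rewrite ge0_integralZl ?lee_fin ?expR_ge0//.
      by rewrite EFinM lee_wpmul2l ?lee_fin ?expR_ge0.
    exact: measurable_expRN_mdist_sqr.
  have mh : measurable_fun [set: borelType X]
      (fun x : borelType X => (T%:E * (expR (- (C * mdist z x ^+ 2)))%:E)%E).
    by apply: emeasurable_funM => //; exact: measurable_expRN_mdist_sqr.
  apply: (@le_trans _ _ (\int[m]_(x in ~` cball z r0)
      (T%:E * (expR (- (C * mdist z x ^+ 2)))%:E))%E); last first.
    apply: ge0_subset_integral => //.
    by move=> x _; rewrite mule_ge0 ?lee_fin ?expR_ge0.
  apply: ge0_le_integral => //.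
  - exact: measurable_funTS.
  - exact: measurable_funTS.
  - move=> x /negP; rewrite /cball/= -ltNge => zx.
    rewrite /g -EFinM lee_fin /T -expRD ler_expR /y.
    have : r0 ^+ 2 <= mdist z x ^+ 2.
      by rewrite lerXn2r ?nnegrE ?mdist_ge0 ?ltW.
    rewrite -subr_ge0 => h; have := mulr_ge0 h (_ : 0 <= (2 * s ^+ 2)^-1 - C).
    by rewrite subr_ge0 => /(_ Cs); lra.
rewrite lee_fin powR_half; last by rewrite mulr_ge0// ?sqr_ge0 ?ltW.
rewrite sqrtrM ?(ltW p0)// sqrtr_sqr ger0_norm ?(ltW s0)// exprMn mulrA -/E.
apply: (@le_trans _ _ (D * (s ^+ 2) ^+ N)).
  have -> : D * (s ^+ 2) ^+ N = expR (C * r0 ^+ 2) * K * (N`!%:R / y ^+ N).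
    rewrite -exprVn /y invf_div /D.
    have -> : 2 * s ^+ 2 / r0 ^+ 2 = 2 / r0 ^+ 2 * s ^+ 2 by rewrite mulrAC.
    by rewrite [in RHS](exprMn _ (2 / r0 ^+ 2)) (mulrC (expR _) K) !mulrA.
  rewrite /T expRD mulrAC ler_wpM2l ?mulr_ge0 ?expR_ge0//.
  rewrite expRN ler_pdivlMr ?exprn_gt0// mulrC ler_pdivrMr ?expR_gt0//.
  by rewrite exprn_le_expR// ltW.
rewrite exprAC expr2 mulrA ler_wpM2r ?exprn_ge0 ?(ltW s0)//.
apply: (@le_trans _ _ (D * s)).
  rewrite ler_wpM2l// -[leRHS]expr1; apply: ler_wiXn2l => //.
  exact: ltW.
apply: (@le_trans _ _ (D * (E / (D + 1)))); first by rewrite ler_wpM2l.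
rewrite mulrA ler_pdivrMr; last by rewrite ltr_wpDl.
by rewrite mulrC ler_pM2l// lerDl.
Qed.

End metric_measure.

(** * The bound at a fixed centre *)

Section entropy_bound.
Context {R : realType} {X : completeMetricType R}.
Variables (m : {measure set (borelType X) -> \bar R}) (N : nat).
Hypothesis N_gt0 : (0 < N)%N.
Hypothesis rcd : RCD0 m N%:R.

(** The left-hand side is the bound of [geodesic_second_moment]; as e and then k
    tend to 0 it tends to t^2 V. *)
Lemma small_interpolation_parameters (V kappa t : R) :
  0 <= V -> 0 < kappa -> 0 < t <= 1 ->
  exists k e : R, [/\ 0 < k, 0 < e &
    (1 + k^-1) * e + (1 + k) * (t ^+ 2 * ((1 + k^-1) * e + (1 + k) * V)) <=
      t ^+ 2 * (V + kappa)].
Proof.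
move=> V0 kappa0 /andP[t0 t1].
pose k := Num.min 1 (kappa / (6 * (V + 1))).
have k0 : 0 < k by rewrite lt_min ltr01 divr_gt0// mulr_gt0// ltr_wpDl.
have k1 : k <= 1 by rewrite ge_min lexx.
have kV : k * V * 6 <= kappa.
  have : k <= kappa / (6 * (V + 1)) by rewrite ge_min lexx orbT.
  rewrite ler_pdivlMr; last by rewrite mulr_gt0// ltr_wpDl.
  by lra.
have tt : t ^+ 2 <= 1 by rewrite exprn_ile1// ltW.
have tt0 : 0 < t ^+ 2 by rewrite exprn_gt0.
have k2 : 0 < 1 + k^-1 by rewrite addr_gt0// invr_gt0.
pose e := t ^+ 2 * kappa / (6 * (1 + k^-1)).
exists k, e; split => //.
  by rewrite divr_gt0 ?mulr_gt0.
have -> : (1 + k^-1) * e = t ^+ 2 * kappa / 6.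
  by rewrite /e; field; rewrite !gt_eqF// addr_gt0.
have kk : k ^+ 2 <= k by rewrite expr2 ler_piMl// ltW.
have h1 : (1 + k) ^+ 2 * V <= V + kappa / 2.
  have := ler_wpM2r V0 kk; nra.
have h2 : (1 + k) * (t ^+ 2 * kappa / 6) <= 2 * (kappa / 6).
  apply: ler_pM; [by lra| |by lra|].
    by rewrite divr_ge0// mulr_ge0// ltW.
  by rewrite ler_pM2r// ler_piMl// ltW.
have -> : t ^+ 2 * kappa / 6 + (1 + k) * (t ^+ 2 * (t ^+ 2 * kappa / 6 + (1 + k) * V))
  = t ^+ 2 * (kappa / 6 + (1 + k) * (t ^+ 2 * kappa / 6) + (1 + k) ^+ 2 * V) by ring.
by rewrite ler_pM2l//; lra.
Qed.

(** Concavity of the entropy power along the geodesic from a measure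
    concentrated at z to nu gives t U(nu) <= U(mu_t).  The Gibbs inequality for
    mu_t, with a Gaussian of width s t, bounds the right-hand side; the time t
    is chosen so small that s t is in the range of [gaussian_mass_le]. *)
Lemma entropy_bound_at (nu : probability (borelType X) R) (z : X)
    (r0 eta V kappa s : R) :
  0 < r0 -> 0 < eta ->
  (forall r, 0 < r <= r0 ->
    (m (cball z r) <= ((1 + eta) * (unit_ball_volume N * r ^+ N))%:E)%E) ->
  (second_moment nu z <= V%:E)%E -> Ent m nu \is a fin_num ->
  0 < kappa -> 0 < s ->
  - fine (Ent m nu) <= (V + kappa) / (2 * s ^+ 2) + ln (1 + eta + eta) +
    N%:R / 2 * ln (2 * pi * s ^+ 2).
Proof.
move=> r00 eta0 ball_le nuV Efin kappa0 s0.
have [mms _ cd] := rcd; have [sepX _ _ _] := mms.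
have V0 : 0 <= V by rewrite -lee_fin (le_trans (second_moment_ge0 nu z)).
have [s1 [s10 mass_le]] := gaussian_mass_le mms N_gt0 r00 eta0 ball_le.
pose t := Num.min 1 (s1 / s).
have t0 : 0 < t by rewrite lt_min ltr01 divr_gt0.
have t1 : t <= 1 by rewrite ge_min lexx.
have st : s * t <= s1 by rewrite mulrC -ler_pdivlMr// ge_min lexx orbT.
have t01 : t \in `[0%R, 1%R] by rewrite in_itv/= (ltW t0).
have [k [e [k0 e0 ke]]] : exists k e : R, [/\ 0 < k, 0 < e &
    (1 + k^-1) * e + (1 + k) * (t ^+ 2 * ((1 + k^-1) * e + (1 + k) * V)) <=
      t ^+ 2 * (V + kappa)].
  by apply: small_interpolation_parameters => //; rewrite t0.
have [mu0 [mu0e mu0fin]] := exists_concentrated_measure mms z e0.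
have [||//|//|mu_ [mu00 mu11 geo Uconc]] := cd mu0 nu.
- by exists z; rewrite (le_lt_trans mu0e)// ltry.
- by exists z; rewrite (le_lt_trans nuV)// ltry.
have mut : (second_moment (mu_ t) z <= (t ^+ 2 * (V + kappa))%:E)%E.
  apply: le_trans (_ : _ <= ((1 + k^-1) * e +
      (1 + k) * (t ^+ 2 * ((1 + k^-1) * e + (1 + k) * V)))%:E)%E _; last first.
    by rewrite lee_fin.
  apply: geodesic_second_moment => //.
    by rewrite (meas_eq_second_moment _ mu00).
  by rewrite (meas_eq_second_moment _ mu11).
pose c := ln ((1 + eta + eta) * (2 * pi * (s * t) ^+ 2) `^ (N%:R / 2)).
have p0 : 0 < 2 * pi :> R by rewrite mulr_gt0// pi_gt0.
have st0 : 0 < s * t by rewrite mulr_gt0.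
have stt : 0 < 2 * pi * (s * t) ^+ 2 by rewrite mulr_gt0// exprn_gt0.
have eta1 : 0 < 1 + eta + eta by rewrite !addr_gt0.
have Entt : ((- ((V + kappa) / (2 * s ^+ 2) + c))%:E <= Ent m (mu_ t))%E.
  apply: (@Ent_ge _ _ m (mu_ t) (fun x => mdist z x ^+ 2 / (2 * (s * t) ^+ 2))).
  - by apply: measurable_funM => //; exact: measurable_mdist_sqr.
  - by move=> x; rewrite divr_ge0 ?sqr_ge0// mulr_ge0// sqr_ge0.
  - under eq_integral do rewrite EFinM.
    have st2 : 0 <= (2 * (s * t) ^+ 2)^-1.
      by rewrite invr_ge0 mulr_ge0// sqr_ge0.
    rewrite ge0_integralZr ?lee_fin//; last 2 first.
    + by apply/measurable_EFinP; exact: measurable_mdist_sqr.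
    + by move=> x _; rewrite lee_fin sqr_ge0.
    have -> : (V + kappa) / (2 * s ^+ 2) =
        t ^+ 2 * (V + kappa) / (2 * (s * t) ^+ 2).
      by field; rewrite !gt_eqF.
    by rewrite EFinM lee_wpmul2r.
  - rewrite lnK ?posrE ?mulr_gt0 ?powR_gt0//; apply: mass_le.
    by rewrite st0.
have n0 : 0 < N%:R :> R by rewrite ltr0n.
pose A := (V + kappa) / (2 * s ^+ 2) + c.
have : (t%:E * U_ m N%:R nu <= U_ m N%:R (mu_ t))%E.
  apply: le_trans (Uconc t t01); rewrite leeDr// mule_ge0 ?expeR_ge0//.
  by rewrite lee_fin subr_ge0.
have Ut : (U_ m N%:R (mu_ t) <= (expR (A / N%:R))%:E)%E.
  rewrite /U_ -[leRHS]/(expeR (A / N%:R)%:E) lee_expeR mulNe.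
  rewrite (_ : (A / N%:R)%:E = - ((N%:R^-1)%:E * (- A)%:E))%E; last first.
    by rewrite -EFinM -EFinN mulrN opprK mulrC.
  by rewrite leeN2 lee_wpmul2l// lee_fin invr_ge0 ltW.
move=> /le_trans/(_ Ut).
have -> : U_ m N%:R nu = (expR (- (N%:R^-1 * fine (Ent m nu))))%:E.
  by rewrite /U_ mulNe -{1}(fineK Efin) -EFinM.
rewrite -EFinM lee_fin.
rewrite -ler_ln; last 2 first.
- by rewrite posrE mulr_gt0 ?expR_gt0.
- by rewrite posrE expR_gt0.
rewrite (@lnM _ t) ?posrE ?expR_gt0// !expRK.
have -> : A = (V + kappa) / (2 * s ^+ 2) + ln (1 + eta + eta) +
    N%:R / 2 * ln (2 * pi * s ^+ 2) + N%:R * ln t.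
  rewrite /A /c (@lnM _ (1 + eta + eta)) ?posrE ?powR_gt0// ln_powR.
  have -> : 2 * pi * (s * t) ^+ 2 = 2 * pi * s ^+ 2 * t ^+ 2 by rewrite exprMn mulrA.
  rewrite (@lnM _ (2 * pi * s ^+ 2)) ?posrE ?(mulr_gt0 p0) ?exprn_gt0//.
  by rewrite (lnXn 2 t0) mulr2n; field; rewrite !gt_eqF.
rewrite ler_pdivlMr// mulrDl mulNr mulrAC mulVf ?gt_eqF// mul1r; lra.
Qed.

Hypothesis m_hausdorff :
  forall A : set X, measurable (A : set (borelType X)) -> m A = hausdorff N A.

(** Integrate d(y,x)^2 <= (1 + 1/k) d(y,z)^2 + (1 + k) d(z,x)^2 in x, with k
    small depending on V and then y close to z depending on k. *)
Lemma second_moment_upper_semicontinuous (nu : probability (borelType X) R)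
    (z : X) (V kappa : R) :
  (second_moment nu z <= V%:E)%E -> 0 < kappa ->
  exists r, 0 < r /\ forall y, mdist y z < r ->
    (second_moment nu y <= (V + kappa)%:E)%E.
Proof.
move=> nuV kappa0.
have V0 : 0 <= V by rewrite -lee_fin (le_trans (second_moment_ge0 nu z)).
pose k := kappa / (2 * (V + 1)).
have k0 : 0 < k by rewrite divr_gt0// mulr_gt0// ltr_wpDl.
have k2 : 0 < 1 + k^-1 by rewrite addr_gt0// invr_gt0.
pose r := Num.sqrt (kappa / 2 / (1 + k^-1)).
have r0 : 0 < r by rewrite sqrtr_gt0 !divr_gt0.
exists r; split => // y yz.
have m1 : measurable_fun [set: borelType X] (fun x : borelType X => mdist y z ^+ 2).
  exact: measurable_cst.
have := @le_integral_lincomb R _ (borelType X) nu (1 + k^-1) (1 + k)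
  _ _ _ (ltW k2) (ltW (addr_gt0 ltr01 k0)) (measurable_mdist_sqr y) m1
  (measurable_mdist_sqr z).
move=> /(_ (fun x => sqr_ge0 _) (fun x => sqr_ge0 _) (fun x => sqr_ge0 _)).
move=> /(_ (fun x => mdist_sqr_le y z x k0)) /le_trans; apply.
have -> : (\int[nu]_(x in [set: borelType X]) (mdist y z ^+ 2)%:E =
    (mdist y z ^+ 2)%:E)%E.
  rewrite integral_cst//= -[RHS]mule1; congr (_ * _)%E.
  exact: probability_setT.
apply: (@le_trans _ _ ((1 + k^-1) * mdist y z ^+ 2 + (1 + k) * V)%:E).
  rewrite [leRHS]EFinD !EFinM leeD// lee_wpmul2l// lee_fin.
  by rewrite ltW// addr_gt0.
have yr : (1 + k^-1) * mdist y z ^+ 2 <= kappa / 2.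
  rewrite mulrC -ler_pdivlMr//.
  rewrite -[leRHS]sqr_sqrtr; last by rewrite ltW// !divr_gt0.
  by rewrite lerXn2r ?nnegrE ?mdist_ge0 ?sqrtr_ge0// ltW.
have kV : k * V <= kappa / 2.
  rewrite /k mulrAC ler_pdivrMr; last by rewrite mulr_gt0// ltr_wpDl.
  by rewrite mulrCA; lra.
by rewrite lee_fin; lra.
Qed.

(** Apply the previous bound at a point of good density close to z.  Both losses,
    in the second moment and in log(1 + 2 eta), are at most e / 2. *)
Lemma entropy_bound_everywhere (nu : probability (borelType X) R) (z : X)
    (V s : R) :
  (second_moment nu z <= V%:E)%E -> Ent m nu \is a fin_num -> 0 < s ->
  - fine (Ent m nu) <= V / (2 * s ^+ 2) + N%:R / 2 * ln (2 * pi * s ^+ 2).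
Proof.
move=> nuV Efin s0; apply/ler_addgt0Pr => e e0.
have ss0 : 0 < 2 * s ^+ 2 by rewrite mulr_gt0// exprn_gt0.
pose kappa := e / 4 * (2 * s ^+ 2).
have kappa0 : 0 < kappa by rewrite mulr_gt0// divr_gt0.
pose eta := e / 4.
have eta0 : 0 < eta by rewrite divr_gt0.
have [r [r0 rP]] := second_moment_upper_semicontinuous nuV kappa0.
have [[_ lf ms _] _ _] := rcd.
have [U [oU Uz] mU] := lf z.
pose W := U `&` [set y | mdist z y < r].
have oW : open W by apply: openI => //; exact: open_mdist_lt.
have Wz : W z by split => //=; rewrite mdistxx.
have W0 : (0 < m W)%E.
  have zs : msupp m z by rewrite ms.
  exact: zs.
have Wy : (m W < +oo)%E.
  apply: le_lt_trans mU; apply: le_measure; last by move=> x [].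
    by rewrite inE; exact: open_borel.
  by rewrite inE; exact: open_borel.
have [y [[_ /= zy] [r0' [r00 ball_le]]]] :=
  exists_upper_density_le N_gt0 (unit_ball_volume_gt0 N) m_hausdorff oW W0 Wy eta0.
have ball_le' r' : 0 < r' <= r0' / 2 ->
    (m (cball y r') <= ((1 + eta) * (unit_ball_volume N * r' ^+ N))%:E)%E.
  by move=> /andP[r'0 r'r]; apply: ball_le; rewrite r'0/=; lra.
have yV := rP y; rewrite (metric_sym y z) in yV.
have := @entropy_bound_at nu y (r0' / 2) eta (V + kappa) kappa s.
move=> /(_ _ eta0 ball_le' (yV zy) Efin kappa0 s0); rewrite divr_gt0// => /(_ isT).
move=> /le_trans; apply.
have : ln (1 + eta + eta) <= e / 2.
  rewrite -addrA; apply: le_trans (le_ln1Dx _) _; last by rewrite /eta; lra.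
  by rewrite (lt_trans (ltrN10 _))// addr_gt0.
have -> : (V + kappa + kappa) / (2 * s ^+ 2) = V / (2 * s ^+ 2) + e / 2.
  by rewrite /kappa; field; rewrite gt_eqF.
by lra.
Qed.

End entropy_bound.

(** * Optimisation of the width *)

Section gaussian_optimisation.
Context {R : realType}.

(** For v > 0 the best width is s^2 = v / N.  For v = 0 the bound would force L
    to be -oo as s tends to 0; the width used makes the bound equal to L - 1. *)
Lemma entropy_of_variance_bounds (N : nat) (v L : R) : (0 < N)%N -> 0 <= v ->
  (forall s, 0 < s -> L <= v / (2 * s ^+ 2) + N%:R / 2 * ln (2 * pi * s ^+ 2)) ->
  0 < v /\ L <= N%:R / 2 * ln (2 * pi * expR 1 / N%:R * v).
Proof.
move=> N0 v0 bound.
have n0 : 0 < N%:R :> R by rewrite ltr0n.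
have p0 : 0 < 2 * pi :> R by rewrite mulr_gt0// pi_gt0.
have vpos : 0 < v.
  rewrite lt_neqAle v0 andbT; apply/eqP => v00.
  pose a := expR (2 / N%:R * (L - 1)) / (2 * pi).
  have a0 : 0 < a by rewrite divr_gt0// expR_gt0.
  have := bound (Num.sqrt a); rewrite sqrtr_gt0 => /(_ a0).
  rewrite sqr_sqrtr ?(ltW a0)// -v00 mul0r add0r.
  have -> : 2 * pi * a = expR (2 / N%:R * (L - 1)).
    by rewrite /a mulrC divfK// gt_eqF.
  rewrite expRK.
  have -> : N%:R / 2 * (2 / N%:R * (L - 1)) = L - 1 by field; rewrite gt_eqF.
  by lra.
split => //.
have vN : 0 < v / N%:R by rewrite divr_gt0.
have := bound (Num.sqrt (v / N%:R)); rewrite sqrtr_gt0 => /(_ vN).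
rewrite sqr_sqrtr ?(ltW vN)//.
have -> : 2 * pi * expR 1 / N%:R * v = 2 * pi * (v / N%:R) * expR 1 by ring.
rewrite (@lnM _ (2 * pi * (v / N%:R))) ?posrE ?(mulr_gt0 p0) ?expR_gt0// expRK.
have -> : v / (2 * (v / N%:R)) = N%:R / 2 by field; rewrite !gt_eqF.
by lra.
Qed.

End gaussian_optimisation.

Theorem theoremB1 (R : realType) (X : completeMetricType R) (N : nat)
    (m : {measure set (borelType X) -> \bar R})
    (nu : probability (borelType X) R) :
  (2 <= N)%N ->
  noncollapsed_RCD0 m N ->
  in_P2 nu ->
  (- Ent m nu <=
    (N%:R / 2)%:E * lne ((2 * pi * expR 1 / N%:R)%:E * Var nu))%E.
Proof.
move=> N2 [rcd m_hausdorff] [x0 nuy].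
have N0 : (0 < N)%N by exact: ltn_trans N2.
have [mms _ _] := rcd.
have Var0 : (0 <= Var nu)%E.
  by apply: le_ereal_inf_tmp => _ [z _ <-]; exact: second_moment_ge0.
have Varfin : Var nu \is a fin_num.
  rewrite ge0_fin_numE// (le_lt_trans _ nuy)//.
  by apply: ereal_inf_lbound; exists x0.
have [Efin|] := boolP (Ent m nu \is a fin_num); last first.
  rewrite fin_numE negb_and !negbK => /orP[/eqP EN|/eqP ->].
    by have := Ent_gtNy mms nuy; rewrite EN.
  by rewrite leNye.
have v0 : 0 <= fine (Var nu) by rewrite fine_ge0.
have [] := @entropy_of_variance_bounds R N (fine (Var nu)) (- fine (Ent m nu)) N0 v0.
  move=> s s0; apply/ler_addgt0Pr => e e0.
  have ss0 : 0 < 2 * s ^+ 2 by rewrite mulr_gt0// exprn_gt0.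
  have ess0 : 0 < e * (2 * s ^+ 2) by rewrite mulr_gt0.
  have [_ [z _ <-] /ltW zV] := lb_ereal_inf_adherent ess0 Varfin.
  rewrite -/(Var nu) -(fineK Varfin) -EFinD in zV.
  have := entropy_bound_everywhere N0 rcd m_hausdorff zV Efin s0.
  by rewrite mulrDl mulfK ?gt_eqF//; lra.
move=> vpos bound.
have n0 : 0 < N%:R :> R by rewrite ltr0n.
rewrite -(fineK Efin) -(fineK Varfin) -EFinM lne_EFin; last first.
  by rewrite mulr_gt0// divr_gt0// mulr_gt0 ?expR_gt0// mulr_gt0// pi_gt0.
by rewrite -EFinM -EFinN lee_fin.
Qed.
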